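(* There exists an absolute constant $C$ such that the following holds. Let $\mathsf{Maj}:\{0,1\}^n\to\{0,1\}$ be the majority function, $\mathsf{Maj}(x)=1$ iff $\sum_i x_i\ge\lceil n/2\rceil$. Let $X,Y$ be random variables on $\{0,1\}^n$ such that the joint distribution $(X,Y)$ on $\{0,1\}^{2n}$ is a $(q,t,\gamma)$-NOBF source. Then $$\left|\mathsf{Maj}(X)\oplus\mathsf{Maj}(Y)-U_1\right|\le C\left(\frac{1}{\sqrt t}+\frac{q}{\sqrt n}\right)+(2n)^t\gamma.$$
   Context: A distribution on $\{0,1\}^N$ is $(t,\gamma)$-wise independent if the marginal on every set of $t$ coordinates is $\gamma$-close in statistical distance to uniform on $\{0,1\}^t$. A source on $\{0,1\}^N$ is a $(q,t,\gamma)$ non-oblivious bit-fixing (NOBF) source if there is a set $Q\subseteq[N]$ of size at most $q$ such that the joint distribution of the bits outside $Q$ is $(t,\gamma)$-wise independent (the bits in $Q$ may depend arbitrarily on the others). $U_1$ is a uniform bit and $|\cdot|$ denotes statistical distance. *)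

(* Defs.v *)
From HB Require Import structures.
From mathcomp Require Export all_boot all_order all_algebra.
From mathcomp Require Export all_classical all_reals all_analysis.

Set Implicit Arguments.
Unset Strict Implicit.
Unset Printing Implicit Defensive.

Import Order.TTheory GRing.Theory Num.Theory.

Local Open Scope classical_set_scope.
Local Open Scope ring_scope.

(* Distributions on a finite type A are given by their mass functions A -> R. *)
Definition law (R : realType) (d : measure_display) (T : measurableType d)
    (P : probability T R) (A : finType) (Z : T -> A) : A -> R :=
  fun a => fine (P (Z @^-1` [set a])).

Definition unif (R : realType) (A : finType) : A -> R := fun=> #|A|%:R^-1.
Arguments unif {R A}.

Definition stat_dist (R : realType) (A : finType) (D E : A -> R) : R :=
  2^-1 * \sum_(a : A) `|D a - E a|.

Notation bits I := {ffun I -> bool}.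

Definition marginal (R : realType) (I : finType) (S : {set I})
    (D : bits I -> R) : bits {i : I | i \in S} -> R :=
  fun y => \sum_(x : bits I | [forall i, x (val i) == y i]) D x.
Arguments marginal {R I} S D.

(* The bound t <= #|I| is implicit in speaking of the sets of t coordinates;
   without it every D would vacuously be (t, gamma)-wise independent as soon
   as t > #|I|. *)
Definition wise_independent (R : realType) (I : finType) (t : nat) (gamma : R)
    (D : bits I -> R) : Prop :=
  (t <= #|I|)%N /\
  forall S : {set I}, #|S| = t -> stat_dist (marginal S D) unif <= gamma.

Definition NOBF (R : realType) (I : finType) (q t : nat) (gamma : R)
    (D : bits I -> R) : Prop :=
  exists Q : {set I},
    (#|Q| <= q)%N /\ wise_independent t gamma (marginal (~: Q) D).

Definition concat_bits (n : nat) (x y : n.-tuple bool) : bits 'I_(n + n) :=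
  [ffun i => tnth (cat_tuple x y) i].

(* uphalf n is n/2 rounded up. *)
Definition maj (n : nat) (x : n.-tuple bool) : bool :=
  (uphalf n <= \sum_(i < n) tnth x i)%N.

(* Main.v *)
Require Import Defs.
From mathcomp Require Import ring lra zify.

(** If [F >= 0] has degree at most [t] on the good bits and dominates the
    indicator of [{Maj X (+) Maj Y = c}], then expanding [F] in characters
    bounds the probability of this event by
    [E F * (1 + 2 * gamma * M)], where [E] is the expectation over uniform
    bits and [M <= (2 n)^t] counts the nonempty sets of at most [t]
    coordinates: the Fourier coefficients of [F] are at most [E F] in absolute
    value, and each character of degree at most [t] has bias at most
    [2 * gamma].

    A suitable [F] is a sum of two products of univariate step majorants
    evaluated at the numbers of ones (or zeros) among [2 p] good bits of each
    block; the threshold is lowered to absorb the bad bits.  The majorant of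
    [1_{u >= 0}] is the Markov-Stieltjes one for the nodes [-N, ..., N]:
    a polynomial [p] of degree [4 N] with
    [1_{u >= 0} <= p u <= 1_{u >= 0} + f u ^ 2] on the whole line, where
    [f u] is the product of the [1 - u^2 / j^2], [1 <= j <= N].  It is [A B]
    with [A] the product of the [(x + j)^2] and [B] the Hermite interpolant of
    [1 / A] at [0, 1, 1, ..., N, N]; all inequalities follow from the complete
    monotonicity of [1 / A].  Since [f u ^ 2 <= exp (12 u^2 / N) min(1, 1/u^2)],
    rescaling [u] by [7 sqrt (p / N)] makes the expectation of [f ^ 2] under
    the binomial law [O (1 / sqrt N)]. *)

Set Implicit Arguments.
Unset Strict Implicit.
Unset Printing Implicit Defensive.

Import Order.TTheory GRing.Theory Num.Theory.

Local Open Scope ring_scope.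

(** * The step majorant *)

Section StepMajorant.
Variable R : realFieldType.
Implicit Types (cs xs : seq R) (T B : {poly R}) (a c x u : R) (N : nat).

Definition shift_prod cs : {poly R} := \prod_(c <- cs) ('X + c%:P).

(* [T / shift_prod cs] is a nonnegative combination of products of the
   functions [1 / (x + c)], [c] in [cs]. *)
Fixpoint completely_monotone cs T : Prop :=
  if cs is c :: cs' then
    exists T1 T2, [/\ completely_monotone cs' T1, completely_monotone cs' T2
                    & T = T1 + ('X + c%:P) * T2]
  else exists2 b, 0 <= b & T = b%:P.

Local Notation cm := completely_monotone.

Lemma cm0 cs : cm cs 0.
Proof.
elim: cs => [|c cs IH]; first by exists 0.
by exists 0, 0; split=> //; rewrite mulr0 addr0.
Qed.

Lemma cm1 cs : cm cs 1.
Proof.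
elim: cs => [|c cs IH]; first by exists 1.
by exists 1, 0; split=> //; [exact: cm0|rewrite mulr0 addr0].
Qed.

Lemma cmD cs T1 T2 : cm cs T1 -> cm cs T2 -> cm cs (T1 + T2).
Proof.
elim: cs T1 T2 => [|c cs IH] T1 T2 /=.
  move=> [b b0 ->] [b' b'0 ->]; exists (b + b'); first exact: addr_ge0.
  by rewrite polyCD.
move=> [U1 [U2 [h1 h2 ->]]] [V1 [V2 [k1 k2 ->]]].
exists (U1 + V1), (U2 + V2); split; [exact: IH|exact: IH|].
by rewrite mulrDr addrACA.
Qed.

Lemma cmZ cs T b : 0 <= b -> cm cs T -> cm cs (b *: T).
Proof.
move=> b0; elim: cs T => [|c cs IH] T /=.
  move=> [b' b'0 ->]; exists (b * b'); first exact: mulr_ge0.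
  by rewrite -mul_polyC -polyCM.
move=> [U1 [U2 [h1 h2 ->]]]; exists (b *: U1), (b *: U2).
by split; [exact: IH|exact: IH|rewrite scalerDr scalerAr].
Qed.

Lemma cm_ge0 cs T x : all (>= 0) cs -> cm cs T -> 0 <= x -> 0 <= T.[x].
Proof.
move=> + + x0; elim: cs T => [|c cs IH] T /=.
  by move=> _ [b b0 ->]; rewrite hornerC.
move=> /andP[c0 cs0] [U1 [U2 [h1 h2 ->]]].
by rewrite !hornerE addr_ge0 ?IH// mulr_ge0 ?addr_ge0 ?IH.
Qed.

Lemma shift_prod_gt0 cs x : all (> 0) cs -> 0 <= x -> 0 < (shift_prod cs).[x].
Proof.
move=> + x0; rewrite /shift_prod; elim: cs => [|c cs IH] /=.
  by rewrite big_nil hornerE.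
move=> /andP[c0 /IH h]; rewrite big_cons !hornerE mulr_gt0//.
by rewrite ltr_wpDl.
Qed.

(* Divided differences of a completely monotone function are, up to sign,
   completely monotone: [-(T/A - T(a)/A(a)) / (x - a)] is again of the form
   [T'/A]. *)
Lemma cm_diff cs T a : all (> 0) cs -> 0 <= a -> cm cs T ->
  exists2 T', cm cs T' &
    T - (T.[a] / (shift_prod cs).[a]) *: shift_prod cs = (a%:P - 'X) * T'.
Proof.
move=> + a0.
suff H : all (> 0) cs -> cm cs T -> exists2 T', cm cs T' &
    T.[a] *: shift_prod cs - (shift_prod cs).[a] *: T =
    (shift_prod cs).[a] *: (('X - a%:P) * T').
  move=> cs0 /(H cs0)[T' cT' e]; exists T' => //.
  have A0 := shift_prod_gt0 cs0 a0.
  apply: (scalerI (lt0r_neq0 A0)).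
  rewrite scalerBr scalerA mulrCA divff ?lt0r_neq0// mulr1.
  by rewrite -opprB e -scalerN -mulNr opprB.
elim: cs T => [|c cs IH] T /=.
  move=> _ [b b0 ->]; exists 0; first by exists 0.
  by rewrite /shift_prod big_nil !hornerE ?(mulr0, scaler0) scale1r alg_polyC subrr.
move=> /andP[c0 cs0] [T1 [T2 [h1 h2 ->]]].
have [D1 cD1 e1] := IH _ cs0 h1.
have [D2 cD2 e2] := IH _ cs0 h2.
have ac0 : 0 < a + c by rewrite ltr_wpDl.
exists ((a + c)^-1 *: T1 + ('X + c%:P) * ((a + c)^-1 *: D1 + D2)).
  exists ((a + c)^-1 *: T1), ((a + c)^-1 *: D1 + D2); split=> //.
    by apply: cmZ => //; rewrite invr_ge0 ltW.
  by apply: cmD => //; apply: cmZ => //; rewrite invr_ge0 ltW.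
rewrite /shift_prod big_cons -/(shift_prod cs) !hornerE.
move: e1 e2; set A := shift_prod cs; rewrite -!mul_polyC => e1 e2.
rewrite !polyCM !polyCD !polyCM polyCD.
have ac : (a%:P + c%:P) * (a + c)^-1%:P = 1 :> {poly R}.
  by rewrite -polyCD -polyCM divff// lt0r_neq0.
rewrite -polyC1 -?polyCD in ac.
transitivity (('X + c%:P) * (T1.[a]%:P * A - A.[a]%:P * T1)
  + A.[a]%:P * T1 * ('X - a%:P)
  + (a%:P + c%:P) * ('X + c%:P) * (T2.[a]%:P * A - A.[a]%:P * T2)).
  ring.
rewrite e1 e2.
transitivity (A.[a]%:P * ('X - a%:P) * (((a%:P + c%:P) * (a + c)^-1%:P) *
   (T1 + ('X + c%:P) * D1) + (a%:P + c%:P) * (('X + c%:P) * D2))); last ring.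
rewrite -polyCD ac; ring.
Qed.

(** The factors are [a - 'X], not ['X - a], so that every product is nonnegative for [x <= 0]
    whatever the number of nodes; there the Newton form of [B] is a sum of nonnegative terms. *)
Definition node_prod xs : {poly R} := \prod_(a <- xs) (a%:P - 'X).

Lemma node_prod_ge0 xs x : all (>= 0) xs -> x <= 0 -> 0 <= (node_prod xs).[x].
Proof.
move=> + x0; rewrite /node_prod; elim: xs => [|a xs IH] /=.
  by rewrite big_nil hornerE.
move=> /andP[a0 /IH h]; rewrite big_cons !hornerE mulr_ge0//.
by rewrite subr_ge0 (le_trans x0).
Qed.

Lemma size_node_prod xs : (size (node_prod xs) <= (size xs).+1)%N.
Proof.
rewrite /node_prod; elim: xs => [|a xs IH]; first by rewrite big_nil size_poly1.
rewrite big_cons; apply: leq_trans (size_polyMleq _ _) _.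
by rewrite -opprB size_polyN size_XsubC.
Qed.

Lemma size_shift_prod cs : size (shift_prod cs) = (size cs).+1.
Proof.
have -> : shift_prod cs = \prod_(c <- cs) ('X - (- c)%:P).
  by apply: eq_bigr => c _; rewrite polyCN opprK.
by rewrite size_prod_XsubC.
Qed.

(* [B] interpolates [1 / shift_prod cs] at the nodes [xs] with multiplicity;
   its coefficients in the Newton basis [node_prod] are nonnegative. *)
Lemma newton_interpolation cs xs : all (> 0) cs -> all (>= 0) xs ->
  exists B T, [/\ (size B <= size xs)%N, forall x, x <= 0 -> 0 <= B.[x],
    cm cs T & shift_prod cs * B = 1 - node_prod xs * T].
Proof.
move=> cs0; elim: xs => [|a xs IH] /=.
  move=> _; exists 0, 1; split; rewrite ?size_poly0//.
  - by move=> x _; rewrite horner0.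
  - exact: cm1.
  - by rewrite /node_prod big_nil mulr0 mul1r subrr.
move=> /andP[a0 xs0]; have [B [T [sB B0 cT e]]] := IH xs0.
have [T' cT' e'] := cm_diff cs0 a0 cT.
set b := T.[a] / _ in e'.
have b0 : 0 <= b.
  apply: divr_ge0; last exact/ltW/shift_prod_gt0.
  by apply: (cm_ge0 _ cT) => //; apply: sub_all cs0 => ? /ltW.
exists (B + b *: node_prod xs), T'; split=> //.
- apply: leq_trans (size_polyD _ _) _; rewrite geq_max (leq_trans sB)//=.
  exact: leq_trans (size_scale_leq _ _) (size_node_prod _).
- by move=> x x0; rewrite !hornerE addr_ge0 ?B0// mulr_ge0// node_prod_ge0.
- rewrite mulrDr e [node_prod (a :: xs)]/node_prod big_cons -/(node_prod xs).
  rewrite -mulrA mulrCA -e' -!mul_polyC; ring.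
Qed.

Definition pos_nats N : seq R := [seq j.+1%:R | j <- iota 0 N].

Lemma pos_nats_gt0 N : all (> 0) (pos_nats N ++ pos_nats N).
Proof. by rewrite all_cat andbb; apply/allP => _ /mapP[j _ ->]; rewrite ltr0n. Qed.

(** The upper bound rests on the identity [p.[u] + p.[- u] = 1 + f u ^ 2], where [f] is the product
    in the statement: subtract [p.[- u] >= 0] when [u >= 0] and [p.[- u] >= 1] when [u < 0]. The
    lower bounds use the form [A * B] on the left, where [B >= 0], and [1 + 'X * node_prod cs * T]
    on the right, where [T >= 0]. *)
Lemma step_majorant N : exists p : {poly R}, [/\ (size p <= (4 * N).+1)%N,
  forall u, 0 <= p.[u], forall u, 0 <= u -> 1 <= p.[u] &
  forall u, p.[u] <=
    (0 <= u)%R%:R + (\prod_(j < N) (1 - (u / j.+1%:R) ^+ 2)) ^+ 2].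
Proof.
set cs := pos_nats N ++ pos_nats N.
have cs0 : all (> 0) cs := pos_nats_gt0 N.
have cs0' : all (>= 0) cs by apply: sub_all cs0 => ? /ltW.
have scs : size cs = (2 * N)%N by rewrite size_cat size_map size_iota mul2n addnn.
have [B [T [sB B0 cT e]]] : exists B T, [/\ (size B <= size (0%R :: cs))%N,
    forall x, x <= 0 -> 0 <= B.[x],
    cm cs T & shift_prod cs * B = 1 - node_prod (0 :: cs) * T].
  by apply: newton_interpolation => //=; rewrite lexx.
set A := shift_prod cs in e.
have AE x : A.[x] = (node_prod cs).[- x].
  rewrite /A /shift_prod /node_prod !horner_prod.
  by apply: eq_bigr => c _; rewrite !hornerE opprK addrC.
have e1 : A * B = 1 + 'X * node_prod cs * T.
  by rewrite e /node_prod big_cons -/(node_prod cs) sub0r !mulNr opprK.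
have A2 x : 0 <= A.[x] /\ 0 <= (node_prod cs).[x].
  rewrite AE /node_prod /cs !big_cat /= !hornerM -!expr2.
  by split; apply: sqr_ge0.
have [p pE] : exists p, p = A * B by exists (A * B).
have p0 : p.[0] = 1 by rewrite pE e1 !hornerE.
have sp : (size p <= (4 * N).+1)%N.
  rewrite pE; apply: leq_trans (size_polyMleq _ _) _.
  by rewrite size_shift_prod; move: sB; rewrite /= scs; lia.
have p_ge0 u : 0 <= p.[u].
  have [u0|/ltW u0] := leP u 0.
    by rewrite pE hornerM mulr_ge0 ?B0//; case: (A2 u).
  rewrite pE e1 !hornerE addr_ge0// mulr_ge0 ?(cm_ge0 _ cT)//.
  by rewrite mulr_ge0//; case: (A2 u).
have p_ge1 u : 0 <= u -> 1 <= p.[u].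
  move=> u0; rewrite pE e1 !hornerE lerDl mulr_ge0 ?(cm_ge0 _ cT)//.
  by rewrite mulr_ge0//; case: (A2 u).
(* Scales [A * node_prod cs], which has double zeros at all nonzero integers of [[-N, N]], to the
   value 1 at 0; this makes it [f ^ 2]. *)
pose k := A.[0]^-1 ^+ 2.
have A00 : A.[0] != 0 by rewrite lt0r_neq0 // shift_prod_gt0.
pose D := p + (p \Po (- 'X)) - 1 - k *: (A * node_prod cs).
have AX : A \Po (- 'X) = node_prod cs.
  rewrite /A /shift_prod /node_prod rmorph_prod /=.
  by apply: eq_bigr => c _; rewrite comp_polyD comp_polyX comp_polyC addrC.
have XX : (- 'X) \Po (- 'X) = 'X :> {poly R}.
  by rewrite rmorphN /= comp_polyX opprK.
have NX : node_prod cs \Po (- 'X) = A.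
  rewrite -AX -comp_polyA XX.
  by rewrite comp_polyXr.
have DX : D \Po (- 'X) = D.
  rewrite /D !comp_polyB comp_polyD [(k *: _) \Po _]comp_polyZ comp_polyM.
  rewrite AX NX -comp_polyA XX.
  rewrite comp_polyXr [node_prod cs * A]mulrC.
  by rewrite -[1]/(1%:P) comp_polyC [_ + p]addrC.
have DA : A %| D.
  rewrite /D.
  have -> : p \Po (- 'X) = 1 - 'X * A * (T \Po (- 'X)).
    rewrite pE e1 comp_polyD !comp_polyM comp_polyX NX.
    by rewrite -[1]/(1%:P) comp_polyC !mulNr.
  rewrite pE; have -> : forall P1 P2 P3 : {poly R},
     A * P1 + (1 - 'X * A * P2) - 1 - k *: (A * P3) =
     A * (P1 - 'X * P2 - k%:P * P3).
    by move=> P1 P2 P3; rewrite -mul_polyC; ring.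
  exact: dvdp_mulIl.
have DN : node_prod cs %| D.
  by rewrite -DX -AX; apply: dvdp_comp_poly.
have DX0 : 'X %| D.
  rewrite -['X]subr0 -[0 in X in X %| _]/(0%:P) dvdp_XsubCl /root /D.
  rewrite !hornerE horner_comp !hornerE oppr0 p0.
  have -> : (node_prod cs).[0] = A.[0] by rewrite AE oppr0.
  by rewrite /k exprVn /= -mulrA -expr2 mulVf ?expf_neq0// addrK subrr.
have cop cs1 : all (> 0) cs1 -> coprimep A (node_prod cs1).
  move=> h; rewrite /node_prod.
  elim: cs1 h => [|c l IH] /=; first by rewrite big_nil coprimep1.
  move=> /andP[c0 /IH l0]; rewrite big_cons coprimepMr l0 andbT.
  rewrite -opprB -scaleN1r coprimepZr ?oppr_eq0 ?oner_eq0//.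
  by rewrite coprimep_XsubC /root lt0r_neq0 ?shift_prod_gt0// ltW.
(* ['X], [A] and [node_prod cs] are pairwise coprime divisors of [D] of total degree [4 N + 1],
   while [D] has degree at most [4 N]. *)
have D0 : D = 0.
  apply/eqP; apply: contraT => Dn0.
  have : 'X * (A * node_prod cs) %| D.
    rewrite Gauss_dvdp ?DX0 ?Gauss_dvdp ?DA ?cop//.
    rewrite coprimepMr -['X]subr0 -[0 in X in 'X - X]/(0%:P).
    rewrite ![coprimep ('X - _) _]coprimep_sym !coprimep_XsubC /root.
    have -> : (node_prod cs).[0] = A.[0] by rewrite AE oppr0.
    by rewrite A00.
  move=> /(dvdp_leq Dn0).
  have sN : size (node_prod cs) = size A.
    by rewrite -AX size_comp_poly2 // size_polyN size_polyX.
  have An0 : A != 0 by rewrite -size_poly_eq0 size_shift_prod.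
  have Nn0 : node_prod cs != 0 by rewrite -size_poly_eq0 sN size_poly_eq0.
  rewrite size_mul ?polyX_eq0 ?mulf_neq0// size_polyX /= size_mul// sN.
  rewrite size_shift_prod scs /= addnS /= => h.
  have sD : (size D <= (4 * N).+1)%N.
    rewrite /D; apply: leq_trans (size_polyD _ _) _; rewrite geq_max size_polyN.
    apply/andP; split.
      apply: leq_trans (size_polyD _ _) _; rewrite geq_max size_polyN size_poly1 andbT.
      apply: leq_trans (size_polyD _ _) _; rewrite geq_max sp.
      by rewrite size_comp_poly2 // size_polyN size_polyX.
    apply: leq_trans (size_scale_leq _ _) _; rewrite size_mul// sN.
    by rewrite size_shift_prod scs /= addnS /= -mulnDl.
  by have := leq_trans h sD; rewrite -mulnDl ltnn.
exists p; split=> // u.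
have f2 : k * (A.[u] * (node_prod cs).[u]) =
    (\prod_(j < N) (1 - (u / j.+1%:R) ^+ 2)) ^+ 2.
  rewrite /k /A /shift_prod /node_prod /cs !big_cat /= !hornerM !horner_prod.
  set P0 := (X in (X * X)^-1); set P1 := (X in _ * (X * X * _)).
  set P2 := (X in _ * (_ * (X * X))).
  suff -> : \prod_(j < N) (1 - (u / j.+1%:R) ^+ 2) = P0^-1 ^+ 2 * P1 * P2.
    by rewrite !invfM; ring.
  rewrite /P0 /P1 /P2 -prodfV expr2 -!big_split /= big_map.
  have -> : iota 0 N = index_iota 0 N by rewrite /index_iota subn0.
  rewrite big_mkord.
  apply: eq_bigr => j _; rewrite !hornerE.
  have : j.+1%:R != 0 :> R by rewrite pnatr_eq0.
  by move: (j.+1%:R : R) => c c0; field.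
have := congr1 (horner^~ u) D0; rewrite /D !hornerE horner_comp !hornerE /= -mulrA f2 => e2.
have [u0|u0] := leP 0 u.
  by rewrite mulr1n; have := p_ge0 (- u); move: e2; lra.
have : 1 <= p.[- u] by rewrite p_ge1// oppr_ge0 ltW.
by rewrite mulr0n; move: e2; lra.
Qed.
End StepMajorant.

(** * The truncated cardinal sine *)

Section TruncatedSinc.
Variable R : realType.
Implicit Types (u x h : R) (N j p r : nat).

Definition sinc_prod N u : R := \prod_(j < N) (1 - (u / j.+1%:R) ^+ 2).

Lemma sinc_prodN N u : sinc_prod N (- u) = sinc_prod N u.
Proof. by apply: eq_bigr => j _; rewrite mulNr sqrrN. Qed.

Lemma sinc_prod_le1 N u : `|u| <= 1 -> `|sinc_prod N u| <= 1.
Proof.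
move=> u1; rewrite normr_prod; apply: prodr_ile1 => j _; rewrite normr_ge0 /=.
have : (u / j.+1%:R) ^+ 2 <= 1.
  rewrite -real_normK ?num_real// expr_le1// normrM normfV normr_nat.
  by rewrite ler_pdivrMr ?ltr0n// mul1r (le_trans u1)// ler1n.
have := sqr_ge0 (u / j.+1%:R); set x2 := _ ^+ 2 => x0 x1.
by rewrite ler_norml; apply/andP; split; lra.
Qed.

(** Factors with [j.+1 > u] equal 1, and the remaining ones multiply to a single term [u ^ m / m!]
    of the exponential series. *)
Lemma prod_max1_le_expR N u : 0 <= u ->
  \prod_(j < N) Num.max 1 (u / j.+1%:R) <= expR u.
Proof.
move=> u0; elim: N => [|N IH].
  by rewrite big_ord0 -expR0 ler_expR.
have [uN|Nu] := ltP u N.+1%:R.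
  rewrite big_ord_recr /= max_l ?mulr1//.
  by rewrite ler_pdivrMr ?ltr0n// mul1r ltW.
apply: le_trans (expR_ge1Dxn N u0); rewrite ler_wpDl//.
suff -> : \prod_(j < N.+1) Num.max 1 (u / j.+1%:R) = u ^+ N.+1 / N.+1`!%:R by [].
transitivity (\prod_(j < N.+1) (u / j.+1%:R)).
  apply: eq_bigr => j _; rewrite max_r// ler_pdivlMr ?ltr0n// mul1r.
  by apply: le_trans Nu; rewrite ler_nat.
rewrite big_split /= prodr_const card_ord prodfV; congr (_ / _).
by rewrite -natr_prod fact_prod big_add1 /= big_mkord.
Qed.

(** Factor by factor, [|1 - x^2| <= max(1, x)^2]. *)
Lemma sinc_prod_le_expR N u : 0 <= u -> `|sinc_prod N u| <= expR (2 * u).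
Proof.
move=> u0; rewrite expRM_natl.
apply: (@le_trans _ _ ((\prod_(j < N) Num.max 1 (u / j.+1%:R)) ^+ 2)); last first.
  rewrite lerXn2r ?nnegrE ?expR_ge0 ?prod_max1_le_expR// prodr_ge0// => j _.
  by rewrite le_max ler01.
rewrite -prodrXl normr_prod; apply: ler_prod => j _; rewrite normr_ge0 /=.
set x := u / _; have x0 : 0 <= x by rewrite divr_ge0.
have [x1|x1] := leP 1 x.
  have x2 : 1 <= x ^+ 2 by rewrite expr_ge1.
  by rewrite ler_norml; apply/andP; split; lra.
have x2 : x ^+ 2 <= 1 by rewrite expr_le1// ltW.
by have x3 := sqr_ge0 x; rewrite ler_norml expr1n; apply/andP; split; lra.
Qed.

(* [u * sinc_prod N u] is up to a constant the product of the [u - k],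
   [-N <= k <= N], hence almost antiperiodic. *)
Lemma sinc_prod_shift N u :
  u * sinc_prod N u * (u - N.+1%:R) =
  (u - 1) * sinc_prod N (u - 1) * (u + N%:R).
Proof.
elim: N => [|N IH].
  by rewrite /sinc_prod !big_ord0 addr0 !mulr1 mulrC.
rewrite /sinc_prod !big_ord_recr /= -!/(sinc_prod _ _).
have n0 : N.+1%:R != 0 :> R by rewrite pnatr_eq0.
have -> : N.+2%:R = N.+1%:R + 1 :> R by rewrite [LHS]mulrSr.
have NE : N%:R = N.+1%:R - 1 :> R by rewrite [in RHS]mulrSr addrK.
rewrite NE in IH; move: (N.+1%:R : R) n0 IH => n n0 IH.
transitivity (u * sinc_prod N u * (u - n) *
  (- (n + u) * (u - (n + 1)) / n ^+ 2)); first by field.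
by rewrite IH; field.
Qed.

(** Passing from [u - 1] to [u] costs the factor [(u + N) / (N + 1 - u)]. For [u <= N / 2] it is at
    most [1 + 2 (2 u - 1) / N], and [2 (2 u - 1) / N] is exactly the increment of [2 u^2 / N]. *)
Lemma sinc_prod_near N u : (0 < N)%N -> 0 <= u -> u <= N%:R / 2 ->
  `|u * sinc_prod N u| <= expR (2 * u ^+ 2 / N%:R).
Proof.
move=> N0; have n0 : 0 < N%:R :> R by rewrite ltr0n.
move=> u0; have := archi_boundP u0; move: (Num.bound u) => k.
elim: k u u0 => [|k IH] u u0; first by move: u0; lra.
move=> uk uN; have [u1|u1] := leP u 1.
  rewrite normrM; apply: (@le_trans _ _ 1).
    rewrite mulr_ile1 ?normr_ge0//; last first.
      by apply: sinc_prod_le1; rewrite ger0_norm.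
    by rewrite ger0_norm.
  by rewrite -expR0 ler_expR !mulr_ge0 ?sqr_ge0 ?invr_ge0// ltW.
have den0 : 0 < N.+1%:R - u by rewrite -natr1; lra.
have -> : u * sinc_prod N u =
   - ((u - 1) * sinc_prod N (u - 1)) * ((u + N%:R) / (N.+1%:R - u)).
  apply: (mulIf (lt0r_neq0 den0)); rewrite -[in RHS]mulrA divfK ?lt0r_neq0//.
  by rewrite -[in LHS]opprB mulrN sinc_prod_shift mulNr.
rewrite normrM normrN [X in _ * X]ger0_norm; last first.
  by apply: divr_ge0; [apply: addr_ge0; rewrite ?ler0n|exact: ltW].
have -> : 2 * u ^+ 2 / N%:R =
    2 * (u - 1) ^+ 2 / N%:R + 2 * (2 * u - 1) / N%:R.
  by field; rewrite lt0r_neq0.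
rewrite expRD; apply: ler_pM => //.
- by apply: divr_ge0; [apply: addr_ge0; rewrite ?ler0n|exact: ltW].
- by apply: IH; move: u1 uk uN; rewrite -?natr1; lra.
apply: le_trans (expR_ge1Dx _); rewrite ler_pdivrMr//.
have e : 1 <= (N.+1%:R - u) * (2 / N%:R).
  by rewrite mulrA ler_pdivlMr// mul1r -natr1; lra.
have -> : u + N%:R = (N.+1%:R - u) + (2 * u - 1) by rewrite -natr1; ring.
rewrite [leRHS]mulrDl mul1r lerD2l.
have -> : 2 * (2 * u - 1) / N%:R * (N.+1%:R - u) =
   (2 * u - 1) * ((N.+1%:R - u) * (2 / N%:R)) by ring.
by rewrite ler_peMr//; lra.
Qed.

(** Up to [N / 2] the square of the previous bound suffices. Beyond, the crude bounds [u <= expR u]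
    and [sinc_prod_le_expR] give the exponent [6 u], which is at most [12 u^2 / N] once
    [u >= N / 2]; hence the constant 12. *)
Lemma sinc_prod_decay N u : (0 < N)%N ->
  u ^+ 2 * sinc_prod N u ^+ 2 <= expR (12 * u ^+ 2 / N%:R).
Proof.
move=> N0; have n0 : 0 < N%:R :> R by rewrite ltr0n.
wlog u0 : u / 0 <= u.
  move=> H; have [/H//|/ltW u0] := leP 0 u.
  by rewrite -(sinc_prodN N u) -(sqrrN u) H// oppr_ge0.
have [uN|uN] := leP u (N%:R / 2).
  have /(lerXn2r 2 (normr_ge0 _) (expR_ge0 _)) := sinc_prod_near N0 u0 uN.
  rewrite real_normK ?num_real// -exprMn -expRM_natl => /le_trans; apply.
  rewrite ler_expR !mulrA ler_pM2r ?invr_gt0//.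
  by have := sqr_ge0 u; lra.
have u1 : u ^+ 2 <= expR (2 * u).
  rewrite expRM_natl lerXn2r ?nnegrE ?expR_ge0//.
  by apply: le_trans (expR_ge1Dx u); rewrite lerDr.
have /(lerXn2r 2 (normr_ge0 _) (expR_ge0 _)) := sinc_prod_le_expR N u0.
rewrite real_normK ?num_real// -expRM_natl => u2.
apply: (@le_trans _ _ (expR (2 * u) * expR (2 * (2 * u)))).
  by rewrite ler_pM ?sqr_ge0.
rewrite -expRD ler_expR ler_pdivlMr//.
have : 0 <= u * (u - N%:R / 2) by rewrite mulr_ge0// subr_ge0 ltW.
rewrite expr2; lra.
Qed.

Lemma sinc_prod_sqr_le N u : (0 < N)%N ->
  sinc_prod N u ^+ 2 <= expR (12 * u ^+ 2 / N%:R).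
Proof.
move=> N0; have [u1|u1] := leP `|u| 1.
  apply: (@le_trans _ _ 1).
    by rewrite -real_normK ?num_real// expr_le1 ?sinc_prod_le1.
  rewrite -expR0 ler_expR; apply: divr_ge0 => //.
  by apply: mulr_ge0 => //; apply: sqr_ge0.
apply: le_trans (sinc_prod_decay u N0).
rewrite ler_peMl ?sqr_ge0//.
by rewrite -real_normK ?num_real//; apply: exprn_ege1; apply: ltW.
Qed.

End TruncatedSinc.

(** * Binomial weights *)

Section CentralBinomial.
Variable R : realType.
Implicit Types (h : R) (N i j p r : nat).

(** The ratio of consecutive central coefficients is [2 (2 p + 1) / (p + 1)], so the induction step
    reduces to [(2 p + 1) (2 p + 3) <= (2 p + 2)^2]. *)
Lemma central_bin_sqr_le p : (p.*2.+1 * 'C(p.*2, p) ^ 2 <= 16 ^ p)%N.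
Proof.
elim: p => [|p IH]; first by rewrite bin0.
have e : (p.+1 * 'C(p.+1.*2, p.+1) = 2 * p.*2.+1 * 'C(p.*2, p))%N.
  have := mul_bin_down p.*2.+1 p; rewrite /= => h.
  rewrite -mul_bin_diag /= -mulnA h (_ : p.*2.+1 - p = p.+1)%N; last lia.
  by rewrite mulnA mul2n.
have : (p.+1 ^ 2 * (p.+1.*2.+1 * 'C(p.+1.*2, p.+1) ^ 2) <= p.+1 ^ 2 * 16 ^ p.+1)%N.
  have -> : (p.+1 ^ 2 * (p.+1.*2.+1 * 'C(p.+1.*2, p.+1) ^ 2) =
    p.+1.*2.+1 * (p.+1 * 'C(p.+1.*2, p.+1)) ^ 2)%N by rewrite expnMn mulnCA.
  rewrite e expnMn.
  have -> : (p.+1.*2.+1 * ((2 * p.*2.+1) ^ 2 * 'C(p.*2, p) ^ 2) =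
     (4 * p.+1.*2.+1 * p.*2.+1) * (p.*2.+1 * 'C(p.*2, p) ^ 2))%N.
    by ring.
  apply: (@leq_trans ((4 * p.+1.*2.+1 * p.*2.+1) * 16 ^ p)).
    by rewrite leq_mul2l IH orbT.
  by rewrite [(16 ^ p.+1)%N]expnS mulnA leq_mul2r -mulnn; apply/orP; right; nia.
by rewrite leq_pmul2l// expn_gt0.
Qed.

Lemma central_bin_le p : 'C(p.*2, p)%:R / 4 ^+ p <= (Num.sqrt p.*2.+1%:R)^-1 :> R.
Proof.
have s0 : 0 < Num.sqrt p.*2.+1%:R :> R by rewrite sqrtr_gt0 ltr0n.
rewrite ler_pdivrMr ?exprn_gt0// ler_pdivlMl//.
rewrite -(@ler_pXn2r _ 2)// ?nnegrE ?mulr_ge0 ?ler0n ?exprn_ge0 ?(ltW s0)//.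
have -> : (4 ^+ p) ^+ 2 = (16 ^ p)%:R :> R.
  by rewrite natrX -exprM mulnC exprM; congr (_ ^+ p); ring.
rewrite exprMn sqr_sqrtr// -natrX -natrM ler_nat.
exact: central_bin_sqr_le.
Qed.

(** The ratio of consecutive coefficients is [1 - (2 i + 1) / (p + i + 1)], at most
    [expR (- (2 i + 1) / (2 p))] for [i < p]; the odd numbers [2 i + 1] add up to the square in the
    exponent. *)
Lemma bin_gauss_right p i :
  'C(p.*2, p + i)%:R * expR (i%:R ^+ 2 / p.*2%:R) <= 'C(p.*2, p)%:R :> R.
Proof.
elim: i => [|i IH]; first by rewrite addn0 expr0n mul0r expR0 mulr1.
have [pi|ip] := leqP p i.
  by rewrite bin_small ?mul0r// -addnn ltn_add2l.
apply: le_trans IH.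
have -> : i.+1%:R ^+ 2 / p.*2%:R = i%:R ^+ 2 / p.*2%:R + (2 * i).+1%:R / p.*2%:R :> R.
  by rewrite -mulrDl -!natrX -natrD; congr (_%:R / _); rewrite -!mulnn; lia.
rewrite expRD mulrA mulrAC ler_wpM2r ?expR_ge0//.
have e : (p + i).+1%:R * 'C(p.*2, (p + i).+1)%:R = (p - i)%:R * 'C(p.*2, p + i)%:R :> R.
  rewrite -!natrM; congr _%:R; rewrite mul_bin_left; congr (_ * _)%N; lia.
have d0 : 0 < (p + i).+1%:R :> R by rewrite ltr0n.
rewrite addnS -(ler_pM2l d0) mulrA e mulrAC ler_wpM2r//.
rewrite -ler_pdivlMr ?expR_gt0// -expRN.
apply: (@le_trans _ _ ((p + i).+1%:R * expR (- ((2 * i).+1%:R / (p + i).+1%:R)))); last first.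
  rewrite ler_wpM2l// ler_expR lerN2 ler_wpM2l// lef_pV2 ?posrE ?ltr0n//; last lia.
  by rewrite ler_nat; lia.
apply: (@le_trans _ _ ((p + i).+1%:R * (1 - (2 * i).+1%:R / (p + i).+1%:R))); last first.
  by rewrite ler_wpM2l// expR_ge1Dx.
rewrite mulrBr mulr1 mulrCA divff ?lt0r_neq0// mulr1.
by rewrite lerBrDr -natrD ler_nat; lia.
Qed.

Lemma bin_gauss p j :
  'C(p.*2, j)%:R * expR ((j%:R - p%:R) ^+ 2 / p.*2%:R) <= 'C(p.*2, p)%:R :> R.
Proof.
have [pj|/ltnW jp] := leqP p j.
  by rewrite -natrB// -{1}(subnKC pj) bin_gauss_right.
rewrite -opprB sqrrN -natrB// -bin_sub; last by rewrite -addnn (leq_trans jp)// leq_addr.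
by have := bin_gauss_right p (p - j); rewrite addnBA// addnn.
Qed.

(** The Gaussian gain is kept on the left because it has to absorb the growth
    [expR (12 * u ^+ 2 / N%:R)] of the squared truncated sinc. *)
Lemma bin_weight_le p j :
  'C(p.*2, j)%:R / 4 ^+ p * expR ((j%:R - p%:R) ^+ 2 / p.*2%:R)
    <= (Num.sqrt p.*2.+1%:R)^-1 :> R.
Proof.
apply: le_trans (central_bin_le p).
by rewrite mulrAC ler_wpM2r ?invr_ge0 ?exprn_ge0// bin_gauss.
Qed.

Lemma sum_bin_weight p : \sum_(j < p.*2.+1) ('C(p.*2, j)%:R / 4 ^+ p) = 1 :> R.
Proof.
rewrite -mulr_suml -natr_sum.
have -> : (\sum_(j < p.*2.+1) 'C(p.*2, j) = 4 ^ p)%N.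
  have := expnDn 1 1 p.*2; rewrite -mul2n expnM => ->.
  by apply: eq_bigr => j _; rewrite !exp1n !muln1.
by rewrite natrX divff// expf_neq0.
Qed.

Lemma bin_upper_half p :
  \sum_(j < p.*2.+1) ('C(p.*2, j)%:R / 4 ^+ p) * (p < j)%N%:R <= 2^-1 :> R.
Proof.
set S := (X in X <= _).
have S' : S = \sum_(j < p.*2.+1) ('C(p.*2, j)%:R / 4 ^+ p) * (j < p)%N%:R.
  rewrite /S (reindex_inj rev_ord_inj); apply: eq_bigr => j _ /=.
  rewrite subSS bin_sub; last by rewrite -ltnS.
  by congr (_ * (nat_of_bool _)%:R); have := ltn_ord j; lia.
suff : S + S <= 1 by lra.
rewrite {2}S' /S -big_split /= -[leRHS](sum_bin_weight p); apply: ler_sum => j _.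
rewrite -mulrDr ler_piMr ?mulr_ge0 ?invr_ge0 ?exprn_ge0//.
by case: ltngtP; rewrite ?add0r ?addr0.
Qed.

(** Beyond the upper half, only the [r + 1] indices from [p - r] to [p] are counted, each of weight
    at most that of the central term. *)
Lemma bin_threshold p r :
  \sum_(j < p.*2.+1) ('C(p.*2, j)%:R / 4 ^+ p) * (p <= j + r)%N%:R
    <= 2^-1 + r.+1%:R / Num.sqrt p.*2.+1%:R :> R.
Proof.
apply: (@le_trans _ _ (\sum_(j < p.*2.+1) (('C(p.*2, j)%:R / 4 ^+ p) * (p < j)%N%:R
  + (Num.sqrt p.*2.+1%:R)^-1 * (p <= j + r <= p + r)%N%:R))).
  apply: ler_sum => j _.
  have w0 : 0 <= 'C(p.*2, j)%:R / 4 ^+ p :> R by rewrite mulr_ge0 ?invr_ge0 ?exprn_ge0.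
  have [pj|jp] := ltnP p j.
    rewrite (_ : (p <= j + r)%N = true); last lia.
    by rewrite mulr1 lerDl mulr_ge0// invr_ge0 sqrtr_ge0.
  rewrite mulr0 add0r leq_add2r jp andbT ler_wpM2r//.
  apply: le_trans (bin_weight_le p j); rewrite ler_peMr//.
  by rewrite -expR0 ler_expR divr_ge0 ?sqr_ge0.
rewrite big_split /= lerD ?bin_upper_half// -mulr_sumr mulrC ler_wpM2r//.
rewrite -natr_sum ler_nat.
(* The minimum is what survives induction on the number of terms: the count grows from index [p - r]
   on and stops at [r + 1]. *)
suff : (\sum_(j < p.*2.+1) (p <= j + r <= p + r)%N <= minn (p.*2.+1 + r - p) r.+1)%N.
  by move/leq_trans; apply; apply: geq_minr.
elim: p.*2.+1 => [|M IH]; first by rewrite big_ord0.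
rewrite big_ord_recr /=; move: IH; set s := (\sum_(_ < _) _)%N => IH.
by case: (boolP (p <= M + r <= p + r)%N) => /=; lia.
Qed.

End CentralBinomial.

(** * Expectation of the step majorant under the binomial law *)

Section BinomialMajorant.
Variable R : realType.
Implicit Types (h : R) (N i j p r : nat).

(* A telescoping majorant of [min(1, h^2 / v^2)]. *)
Definition inv_sqr_tail h (v : nat) : R :=
  if v is v'.+1 then 4 * h ^+ 2 * ((h + v'%:R)^-1 - (h + v%:R)^-1) else 1.

Lemma inv_sqr_tailS h v : 0 < h ->
  inv_sqr_tail h v.+1 = 4 * h ^+ 2 / ((h + v%:R) * (h + v.+1%:R)).
Proof.
move=> h0 /=.
have v0 : h + v%:R != 0 by rewrite lt0r_neq0// ltr_pwDl.
have v1 : h + v.+1%:R != 0 by rewrite lt0r_neq0// ltr_pwDl.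
rewrite -natr1 in v1 *; field.
by rewrite v1 v0.
Qed.

Lemma inv_sqr_tail_ge0 h v : 0 < h -> 0 <= inv_sqr_tail h v.
Proof.
move=> h0; case: v => [//|v]; rewrite inv_sqr_tailS//.
by rewrite divr_ge0 ?mulr_ge0 ?sqr_ge0 ?addr_ge0 ?ler0n ?(ltW h0).
Qed.

(** The factor 4 in [inv_sqr_tail] pays for [h + v] and [h + v + 1] being at most [2 h] in this
    range, and at most twice the index in the next lemma. *)
Lemma inv_sqr_tail_ge1 h v : 0 < h -> v%:R <= h -> 1 <= inv_sqr_tail h v.
Proof.
move=> h0; case: v => [//|v] vh; rewrite inv_sqr_tailS//.
rewrite ler_pdivlMr ?mulr_gt0 ?ltr_pwDl// mul1r.
have v0 : 0 <= v%:R :> R by [].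
rewrite -natr1 in vh *; nra.
Qed.

Lemma inv_sqr_tail_ge h v : 0 < h -> h <= v.+1%:R ->
  h ^+ 2 / v.+1%:R ^+ 2 <= inv_sqr_tail h v.+1.
Proof.
move=> h0 hv; rewrite inv_sqr_tailS// -mulrA mulrCA ler_wpM2l ?sqr_ge0//.
rewrite -[X in X <= _]div1r ler_pdivrMr ?exprn_gt0// mulrAC.
rewrite ler_pdivlMr ?mulr_gt0 ?ltr_pwDl// mul1r.
have v0 : 0 <= v%:R :> R by [].
rewrite -natr1 in hv *; nra.
Qed.

Lemma sum_inv_sqr_tail h M : 0 < h ->
  \sum_(i < M) inv_sqr_tail h i <= 1 + 4 * h.
Proof.
move=> h0; case: M => [|M]; first by rewrite big_ord0 addr_ge0 ?mulr_ge0 ?(ltW h0).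
have -> : \sum_(i < M.+1) inv_sqr_tail h i =
    1 + 4 * h ^+ 2 * (h^-1 - (h + M%:R)^-1).
  elim: M => [|M IH]; first by rewrite big_ord1 addr0 subrr mulr0 addr0.
  by rewrite big_ord_recr IH /=; ring.
rewrite lerD2l mulrBr.
have -> : 4 * h ^+ 2 * h^-1 = 4 * h by field; rewrite lt0r_neq0.
rewrite lerBlDr lerDl; apply: divr_ge0; last by rewrite addr_ge0 ?(ltW h0).
by apply: mulr_ge0 => //; apply: sqr_ge0.
Qed.

(** Each distance to [k] occurs at most once on either side of [k]. *)
Lemma sum_dist_le (b : nat -> R) M k : (forall v, 0 <= b v) ->
  \sum_(j < M) b (j - k + (k - j))%N <=
  \sum_(i < M) b i + \sum_(i < k.+1) b i.
Proof.
move=> b0.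
have mono m n : (m <= n)%N -> \sum_(i < m) b i <= \sum_(i < n) b i.
  move=> mn; rewrite (big_ord_widen n (fun i => b i) mn) big_mkcond /=.
  by apply: ler_sum => i _; case: ifP.
(* The extra sum on the left holds the distances on the left of [k] not yet met by [j < M], so that
   the bound can be proved by induction on [M]. *)
suff : \sum_(j < M) b (j - k + (k - j))%N + \sum_(i < k.+1 - M) b i
    <= \sum_(i < M - k) b i + \sum_(i < k.+1) b i.
  move=> H; apply: (@le_trans _ _ (\sum_(i < M - k) b i + \sum_(i < k.+1) b i)).
    by apply: le_trans H; rewrite lerDl sumr_ge0.
  by rewrite lerD2r mono// leq_subr.
elim: M => [|M IH]; first by rewrite !big_ord0 !add0r subn0.
rewrite big_ord_recr /=.
have [kM|Mk] := leqP k M.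
  rewrite (_ : k.+1 - M.+1 = 0)%N; last lia.
  rewrite (_ : M.+1 - k = (M - k).+1)%N; last lia.
  rewrite (_ : M - k + (k - M) = M - k)%N; last lia.
  rewrite big_ord0 addr0 big_ord_recr /= addrAC lerD2r.
  by apply: le_trans IH; rewrite lerDl sumr_ge0.
rewrite (_ : M.+1 - k = M - k)%N; last lia.
rewrite (_ : M - k + (k - M) = k - M)%N; last lia.
rewrite -addrA subSS; apply: le_trans IH; rewrite lerD2l.
rewrite (_ : k.+1 - M = (k - M).+1)%N; last lia.
by rewrite big_ord_recr /= addrC.
Qed.

(** The constant 7 makes the exponents fit: with [v] the distance from [j] to [p - r], [12 u^2 / N]
    is [(24 / 49) v^2 / (2 p)], while [v^2 <= 2 (j - p)^2 + 2 r^2] and [r^2 <= 2 p]. The term [r^2]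
    accounts for [expR 1]. *)
Lemma sinc_prod_lattice N p r j h : (0 < N)%N -> (N <= p)%N -> (r ^ 2 <= p.*2)%N ->
  h = 7 * Num.sqrt (p%:R / N%:R) ->
  sinc_prod N ((j%:R + r%:R - p%:R) / h) ^+ 2 <=
  expR ((j%:R - p%:R) ^+ 2 / p.*2%:R) * expR 1
    * inv_sqr_tail h (j - (p - r) + (p - r - j)).
Proof.
move=> N0 Np rp hE.
have n0 : 0 < N%:R :> R by rewrite ltr0n.
have p0 : 0 < p%:R :> R by rewrite ltr0n (leq_trans N0).
have rlep : (r <= p)%N by move: rp; rewrite -mulnn; nia.
have h0 : 0 < h by rewrite hE mulr_gt0// sqrtr_gt0 divr_gt0.
have h2 : h ^+ 2 = 49 * (p%:R / N%:R).
  by rewrite hE exprMn sqr_sqrtr ?divr_ge0//; congr (_ * _); ring.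
set v := (j - (p - r) + (p - r - j))%N.
have v2 : (j%:R + r%:R - p%:R) ^+ 2 = v%:R ^+ 2 :> R.
  have -> : j%:R + r%:R - p%:R = j%:R - (p - r)%N%:R :> R by rewrite natrB//; ring.
  have [jk|/ltnW kj] := leqP j (p - r).
    by rewrite -opprB sqrrN -natrB// /v; congr (_%:R ^+ 2); lia.
  by rewrite -natrB// /v; congr (_%:R ^+ 2); lia.
set u := _ / h.
have u2 : u ^+ 2 = v%:R ^+ 2 / h ^+ 2 by rewrite /u expr_div_n v2.
have eu : expR (12 * u ^+ 2 / N%:R) <=
    expR ((j%:R - p%:R) ^+ 2 / p.*2%:R) * expR 1.
  rewrite -expRD ler_expR u2 -v2 h2.
  have p20 : 0 < p.*2%:R :> R by rewrite ltr0n double_gt0 -(ltr0n R).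
  have -> : 12 * ((j%:R + r%:R - p%:R) ^+ 2 / (49 * (p%:R / N%:R))) / N%:R =
     (24 * (j%:R + r%:R - p%:R) ^+ 2 / 49) / p.*2%:R :> R.
    by rewrite -muln2 natrM; field; rewrite !lt0r_neq0.
  rewrite -[X in _ <= _ + X](divff (lt0r_neq0 p20)).
  rewrite -mulrDl ler_pM2r ?invr_gt0//.
  have r2 : r%:R ^+ 2 <= p.*2%:R :> R by rewrite -natrX ler_nat.
  have -> : j%:R + r%:R - p%:R = (j%:R - p%:R) + r%:R :> R by ring.
  move: (j%:R - p%:R : R) (r%:R : R) r2 => x y.
  have := sqr_ge0 (x - y); have := sqr_ge0 x; have := sqr_ge0 y.
  rewrite !expr2; nra.
have E0 : 0 <= expR ((j%:R - p%:R) ^+ 2 / p.*2%:R) * expR 1 :> R.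
  by rewrite mulr_ge0 ?expR_ge0.
(* Within distance [h] the bound without decay is enough; farther away the decay
   [1 / u^2 = h^2 / v^2] is used. *)
have [vh|hv] := leP v%:R h.
  apply: le_trans (sinc_prod_sqr_le u N0) _; apply: le_trans eu _.
  by rewrite ler_peMr ?inv_sqr_tail_ge1.
case: v hv {v2} u2 => [|v] hv u2; first by move: hv; lra.
apply: (@le_trans _ _ (expR (12 * u ^+ 2 / N%:R) * (h ^+ 2 / v.+1%:R ^+ 2))).
  rewrite -ler_pdivrMr; last by rewrite divr_gt0 ?exprn_gt0.
  apply: le_trans (sinc_prod_decay u N0); rewrite u2 mulrC invf_div.
  by rewrite lexx.
apply: ler_pM => //; last exact/inv_sqr_tail_ge/ltW.
by rewrite divr_ge0 ?sqr_ge0.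
Qed.

(** The step majorant is recentred at [p - r] and dilated by [h]. Its step part contributes the
    binomial tail, its error part a sum of [inv_sqr_tail] of order [h], against weights of order
    [1 / sqrt p]. *)
Lemma binomial_majorant N p r :
  (0 < N)%N -> (N <= p)%N -> (r ^ 2 <= p.*2)%N ->
  exists P : {poly R}, [/\ (size P <= (4 * N).+1)%N, forall x, 0 <= P.[x],
    forall j, (p <= j + r)%N -> 1 <= P.[j%:R] &
    \sum_(j < p.*2.+1) ('C(p.*2, j)%:R / 4 ^+ p) * P.[j%:R] <=
    2^-1 + r.+1%:R / Num.sqrt p.*2.+1%:R + 63 * expR 1 / Num.sqrt N%:R].
Proof.
move=> N0 Np rp; set h : R := 7 * Num.sqrt (p%:R / N%:R).
have n0 : 0 < N%:R :> R by rewrite ltr0n.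
have p0 : 0 < p%:R :> R by rewrite ltr0n (leq_trans N0).
have rlep : (r <= p)%N by move: rp; rewrite -mulnn; nia.
have s1 : 1 <= Num.sqrt (p%:R / N%:R) :> R.
  by rewrite -[leLHS]sqrtr1 ler_wsqrtr// ler_pdivlMr// mul1r ler_nat.
have h7 : 7 <= h by rewrite /h; lra.
have h0 : 0 < h by lra.
have [P0 [sP0 P0ge0 P0ge1 P0le]] := step_majorant R N.
pose L : {poly R} := h^-1 *: ('X + (r%:R - p%:R)%:P).
have LE x : L.[x] = (x + r%:R - p%:R) / h by rewrite /L !hornerE /= mulrC ?addrA.
exists (P0 \Po L); split.
- by rewrite size_comp_poly2// size_scale ?invr_neq0 ?lt0r_neq0// size_XaddC.
- by move=> x; rewrite horner_comp.
- move=> j jp; rewrite horner_comp P0ge1// LE divr_ge0 ?(ltW h0)//.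
  by rewrite subr_ge0 -natrD ler_nat.
have w0 j : 0 <= 'C(p.*2, j)%:R / 4 ^+ p :> R by rewrite divr_ge0 ?exprn_ge0.
set K : nat -> R := fun j => inv_sqr_tail h (j - (p - r) + (p - r - j)).
set s := Num.sqrt p.*2.+1%:R.
have s0 : 0 < s by rewrite sqrtr_gt0 ltr0n.
apply: (@le_trans _ _ (\sum_(j < p.*2.+1)
  (('C(p.*2, j)%:R / 4 ^+ p) * (p <= j + r)%N%:R + s^-1 * expR 1 * K j))).
  apply: ler_sum => j _; rewrite horner_comp LE.
  apply: le_trans (ler_wpM2l (w0 j) (P0le _)) _.
  rewrite mulrDr lerD//.
    have -> : (0 <= (j%:R + r%:R - p%:R) / h) = (p <= j + r)%N => //.
    by rewrite pmulr_lge0 ?invr_gt0// subr_ge0 -natrD ler_nat.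
  apply: le_trans (ler_wpM2l (w0 j) (sinc_prod_lattice j N0 Np rp erefl)) _.
  rewrite -/h -/(K j) !mulrA ler_wpM2r ?inv_sqr_tail_ge0// ler_wpM2r ?expR_ge0//.
  exact: bin_weight_le.
rewrite big_split /= lerD ?bin_threshold// -mulr_sumr.
(* The two sides give [2 (1 + 4 h)], at most [9 h] since [h >= 7]; with the 7 inside [h] this
   produces the constant 63. *)
have KS : \sum_(j < p.*2.+1) K j <= 9 * h.
  have := sum_dist_le p.*2.+1 (p - r) (fun v => inv_sqr_tail_ge0 v h0).
  have := sum_inv_sqr_tail p.*2.+1 h0; have := sum_inv_sqr_tail (p - r).+1 h0.
  rewrite -/(K _); lra.
apply: (@le_trans _ _ (s^-1 * expR 1 * (9 * h))).
  by rewrite ler_wpM2l// mulr_ge0 ?invr_ge0 ?expR_ge0 ?(ltW s0).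
have -> : s^-1 * expR 1 * (9 * h) = 63 * expR 1 * (Num.sqrt (p%:R / N%:R) / s).
  by rewrite /h; ring.
rewrite ler_wpM2l ?mulr_ge0 ?expR_ge0//.
rewrite ler_pdivrMr// sqrtrM ?ler0n// sqrtrV ?ler0n// mulrC.
rewrite ler_wpM2l ?invr_ge0 ?sqrtr_ge0// ler_wsqrtr// ler_nat -addnn.
by rewrite (leq_trans (leq_addr p p)).
Qed.

End BinomialMajorant.

(** * Fourier analysis on the cube *)

Section Fourier.
Import mathcomp.boot.fintype mathcomp.boot.finset.
Variables (R : realType) (I : finType).
Implicit Types (S T J : {set I}) (z : bits I) (F G : bits I -> R) (k : nat).

Definition mean F : R := (\sum_z F z) / #|bits I|%:R.

Definition chi S z : R := \prod_(i in S) (-1) ^+ z i.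

Definition flip (a : I) z : bits I := [ffun i => (i == a) (+) z i].

Lemma flipK a : involutive (flip a).
Proof. by move=> z; apply/ffunP => i; rewrite !ffunE addKb. Qed.

Lemma card_bits_gt0 : 0 < #|bits I|%:R :> R.
Proof. by rewrite ltr0n; apply/card_gt0P; exists [ffun=> false]. Qed.

Lemma mean_ge0 F : (forall z, 0 <= F z) -> 0 <= mean F.
Proof. by move=> F0; rewrite divr_ge0// sumr_ge0. Qed.

Lemma eq_mean F G : F =1 G -> mean F = mean G.
Proof. by move=> FG; congr (_ / _); apply: eq_bigr => z _. Qed.

Lemma meanD F G : mean (fun z => F z + G z) = mean F + mean G.
Proof. by rewrite /mean big_split mulrDl. Qed.

Lemma meanZ (c : R) F : mean (fun z => c * F z) = c * mean F.
Proof. by rewrite /mean -mulr_sumr mulrA. Qed.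

Lemma mean_sum (A : finType) (F : A -> bits I -> R) :
  mean (fun z => \sum_a F a z) = \sum_a mean (F a).
Proof. by rewrite /mean exchange_big /= mulr_suml. Qed.

Lemma mean_flip a F : mean (fun z => F (flip a z)) = mean F.
Proof.
congr (_ / _); rewrite [RHS](reindex_inj (inv_inj (flipK a))).
exact: eq_bigr.
Qed.

Lemma chi0 z : chi set0 z = 1.
Proof. by rewrite /chi big_set0. Qed.

Lemma chi1 a z : chi [set a] z = (-1) ^+ z a.
Proof. by rewrite /chi big_set1. Qed.

Lemma norm_chi S z : `|chi S z| = 1.
Proof.
rewrite /chi normr_prod; apply: big1 => i _.
by rewrite normrX normrN1 expr1n.
Qed.

Definition symdiff S T := (S :\: T) :|: (T :\: S).

Lemma chiM S T z : chi S z * chi T z = chi (symdiff S T) z.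
Proof.
rewrite /chi (big_mkcond (mem S)) (big_mkcond (mem T)) (big_mkcond (mem (symdiff S T))).
rewrite -big_split /=; apply: eq_bigr => i _; rewrite !inE.
by case: (i \in S); case: (i \in T); rewrite /= ?mulr1 ?mul1r// -expr2 sqrr_sign.
Qed.

Lemma symdiff_eq0 S T : (symdiff S T == set0) = (S == T).
Proof. by rewrite /symdiff setU_eq0 !setD_eq0 eqEsubset. Qed.

Lemma mean_chi S : mean (chi S) = (S == set0)%:R.
Proof.
have [->|/set0Pn[a aS]] := eqVneq S set0.
  rewrite /mean (eq_bigr (fun=> 1)) => [|z _]; last exact: chi0.
  by rewrite sumr_const divff ?lt0r_neq0 ?card_bits_gt0.
suff e : mean (chi S) = - mean (chi S) by rewrite mulr0n; lra.
rewrite -[in LHS](mean_flip a) -[in RHS]mulN1r -meanZ; apply: eq_mean => z.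
rewrite /chi !(bigD1 a aS) /= ffunE eqxx /= signrN mulrA !mulN1r; congr (_ * _).
by apply: eq_bigr => i /andP[_ ia]; rewrite ffunE (negPf ia).
Qed.

(** Support and degree are tracked together: the degree is what limited independence controls, and
    disjoint supports make uniform expectations multiply. *)
Definition junta_degree J k F : Prop := exists2 c : {set I} -> R,
  (forall S, c S != 0 -> (S \subset J) && (#|S| <= k)%N) &
  forall z, F z = \sum_S c S * chi S z.

Lemma eq_junta_degree J k F G : F =1 G -> junta_degree J k F -> junta_degree J k G.
Proof. by move=> FG [c cJ cF]; exists c => // z; rewrite -FG. Qed.

Lemma sub_junta_degree J J' k k' F : J \subset J' -> (k <= k')%N ->
  junta_degree J k F -> junta_degree J' k' F.
Proof.
move=> JJ kk [c cJ cF]; exists c => // S /cJ/andP[SJ Sk].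
by rewrite (subset_trans SJ) ?(leq_trans Sk).
Qed.

Lemma junta_degreeD J k F G : junta_degree J k F -> junta_degree J k G ->
  junta_degree J k (fun z => F z + G z).
Proof.
move=> [c cJ cF] [c' cJ' cG]; exists (fun S => c S + c' S) => [S|z].
  have [->|/cJ//] := eqVneq (c S) 0; rewrite add0r; exact: cJ'.
by rewrite cF cG -big_split; apply: eq_bigr => S _; rewrite mulrDl.
Qed.

Lemma junta_degree_chi J k S (a : R) : S \subset J -> (#|S| <= k)%N ->
  junta_degree J k (fun z => a * chi S z).
Proof.
move=> SJ Sk; exists (fun T => if T == S then a else 0) => [T|z].
  by case: (T =P S) => [->|]; rewrite ?SJ ?Sk// eqxx.
rewrite (bigD1 S)//= eqxx big1 ?addr0// => T /negPf TS.
by rewrite TS mul0r.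
Qed.

Lemma junta_degree_cst J k (a : R) : junta_degree J k (fun=> a).
Proof.
apply: (@eq_junta_degree _ _ (fun z => a * chi set0 z)) => [z|].
  by rewrite chi0 mulr1.
by apply: junta_degree_chi; rewrite ?sub0set ?cards0.
Qed.

Lemma junta_degree_sum J k (A : Type) (s : seq A) (P : pred A) (F : A -> bits I -> R) :
  (forall a, P a -> junta_degree J k (F a)) ->
  junta_degree J k (fun z => \sum_(a <- s | P a) F a z).
Proof.
move=> FJ; elim: s => [|a s IH].
  by apply: eq_junta_degree (junta_degree_cst J k 0) => z; rewrite big_nil.
have [Pa|/negPf Pa] := boolP (P a).
  by apply: eq_junta_degree (junta_degreeD (FJ a Pa) IH) => z; rewrite big_cons Pa.
by apply: eq_junta_degree IH => z; rewrite big_cons Pa.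
Qed.

Lemma junta_degreeM J J' k k' F G :
  junta_degree J k F -> junta_degree J' k' G ->
  junta_degree (J :|: J') (k + k') (fun z => F z * G z).
Proof.
move=> [c cJ cF] [c' cJ' cG].
apply: (@eq_junta_degree _ _
  (fun z => \sum_S \sum_T (c S * c' T) * chi (symdiff S T) z)) => [z|].
  rewrite cF cG mulr_suml; apply: eq_bigr => S _; rewrite mulr_sumr.
  by apply: eq_bigr => T _; rewrite -chiM; ring.
apply: junta_degree_sum => S _; apply: junta_degree_sum => T _.
have [c0|/cJ/andP[SJ Sk]] := eqVneq (c S) 0.
  by apply: eq_junta_degree (junta_degree_cst _ _ 0) => z; rewrite c0 !mul0r.
have [c0|/cJ'/andP[TJ Tk]] := eqVneq (c' T) 0.
  by apply: eq_junta_degree (junta_degree_cst _ _ 0) => z; rewrite c0 mulr0 mul0r.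
apply: junta_degree_chi.
  apply: setUSS; apply: subset_trans (subsetDl _ _) _ => //.
apply: leq_trans (leq_card_setU _ _) (leq_add _ _).
  exact: leq_trans (subset_leq_card (subsetDl _ _)) Sk.
exact: leq_trans (subset_leq_card (subsetDl _ _)) Tk.
Qed.

(** Only pairs of equal characters survive in the mean, and a set inside both [J] and [J'] is
    empty. *)
Lemma mean_junta_mul J J' k k' F G : [disjoint J & J'] ->
  junta_degree J k F -> junta_degree J' k' G ->
  mean (fun z => F z * G z) = mean F * mean G.
Proof.
move=> JJ [c cJ cF] [c' cJ' cG].
have m (d : {set I} -> R) H : (forall z, H z = \sum_S d S * chi S z) -> mean H = d set0.
  move=> dH; rewrite (eq_mean dH) mean_sum (bigD1 set0)//= meanZ mean_chi eqxx mulr1.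
  by rewrite big1 ?addr0// => S /negPf S0; rewrite meanZ mean_chi S0 mulr0.
rewrite (m _ _ cF) (m _ _ cG).
rewrite (eq_mean (G := fun z => \sum_S \sum_T (c S * c' T) * chi (symdiff S T) z)); last first.
  move=> z; rewrite cF cG mulr_suml; apply: eq_bigr => S _; rewrite mulr_sumr.
  by apply: eq_bigr => T _; rewrite -chiM; ring.
rewrite mean_sum (eq_bigr (fun S => c S * c' S)) => [|S _]; last first.
  rewrite mean_sum (bigD1 S)//= meanZ mean_chi symdiff_eq0 eqxx mulr1 big1 ?addr0// => T TS.
  by rewrite meanZ mean_chi symdiff_eq0 eq_sym (negPf TS) mulr0.
rewrite (bigD1 set0)//= big1 ?addr0// => S S0.
have [->|/cJ/andP[SJ _]] := eqVneq (c S) 0; first by rewrite mul0r.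
have [->|/cJ'/andP[SJ' _]] := eqVneq (c' S) 0; first by rewrite mulr0.
case/negP: S0; rewrite -subset0.
by move: JJ; rewrite -setI_eq0 => /eqP <-; rewrite subsetI SJ.
Qed.

(** [c S] is the mean of [F * chi S], and characters have absolute value 1. *)
Lemma fourier_coef_le (c : {set I} -> R) F S : (forall z, F z = \sum_T c T * chi T z) ->
  (forall z, 0 <= F z) -> `|c S| <= mean F.
Proof.
move=> cF F0; suff -> : c S = mean (fun z => F z * chi S z).
  rewrite /mean normrM [X in _ * X]ger0_norm ?invr_ge0// ler_wpM2r ?invr_ge0//.
  apply: le_trans (ler_norm_sum _ _ _) _; apply: ler_sum => z _.
  by rewrite normrM norm_chi mulr1 ger0_norm.
rewrite (eq_mean (G := fun z => \sum_T c T * chi (symdiff T S) z)); last first.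
  by move=> z; rewrite cF mulr_suml; apply: eq_bigr => T _; rewrite -chiM mulrA.
rewrite mean_sum (bigD1 S)//= meanZ mean_chi symdiff_eq0 eqxx mulr1 big1 ?addr0// => T TS.
by rewrite meanZ mean_chi symdiff_eq0 (negPf TS) mulr0.
Qed.

(** Such a set is the image of a [t]-tuple, namely its enumeration padded with one of its own
    elements [a]. *)
Lemma card_small_sets t : (0 < t)%N ->
  (#|[set S : {set I} | (S != set0) && (#|S| <= t)%N]| <= #|I| ^ t)%N.
Proof.
move=> t0; rewrite -[X in (_ ^ X)%N](card_ord t) -card_ffun -cardsT.
pose img (f : {ffun 'I_t -> I}) : {set I} := f @: setT.
apply: leq_trans (leq_imset_card img _).
apply/subset_leq_card/subsetP => S; rewrite inE => /andP[/set0Pn[a aS] St].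
apply/imsetP; exists [ffun i : 'I_t => nth a (enum S) i] => //.
apply/setP => b; apply/idP/imsetP => [bS|[i _ ->]].
  have bi : (index b (enum S) < t)%N.
    by rewrite (leq_trans _ St)// cardE index_mem mem_enum.
  by exists (Ordinal bi) => //; rewrite ffunE nth_index ?mem_enum.
rewrite ffunE; have [si|si] := leqP (size (enum S)) i.
  by rewrite nth_default.
by rewrite -mem_enum mem_nth.
Qed.

Lemma biased_mean_le (D F : bits I -> R) t (gamma : R) : (0 < t)%N -> 0 <= gamma ->
  \sum_z D z = 1 ->
  (forall S, S != set0 -> (#|S| <= t)%N -> `|\sum_z D z * chi S z| <= 2 * gamma) ->
  junta_degree setT t F -> (forall z, 0 <= F z) ->
  \sum_z D z * F z <= mean F * (1 + 2 * gamma * (#|I| ^ t)%:R).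
Proof.
move=> t0 g0 D1 Db [c cJ cF] F0.
have cle S : `|c S| <= mean F by exact: fourier_coef_le.
have m0 := mean_ge0 F0.
rewrite (eq_bigr (fun z => \sum_S c S * (D z * chi S z))) => [|z _]; last first.
  by rewrite cF mulr_sumr; apply: eq_bigr => S _; ring.
rewrite exchange_big /= (bigD1 set0)//= mulrDr mulr1; apply: lerD.
  rewrite -mulr_sumr (eq_bigr D) => [|z _]; last by rewrite chi0 mulr1.
  by rewrite D1 mulr1 (le_trans (ler_norm _)).
apply: (@le_trans _ _ (\sum_(S | (S != set0) && (#|S| <= t)%N) mean F * (2 * gamma))).
  rewrite big_mkcondr; apply: ler_sum => S S0 /=; rewrite -mulr_sumr.
  case: leqP => St.
    apply: le_trans (ler_norm _) _; rewrite normrM.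
    by apply: ler_pM => //; apply: Db.
  have -> : c S = 0; last by rewrite mul0r.
  by apply/eqP; apply: contraTT St => /cJ/andP[_]; rewrite -leqNgt.
rewrite sumr_const -[leLHS]mulr_natr -mulrA ler_wpM2l// ler_wpM2l ?mulr_ge0// ler_nat.
apply: leq_trans (card_small_sets t0); rewrite subset_leq_card//.
by apply/subsetP => S; rewrite !inE.
Qed.

(** The bit [b] is a parameter so that majority 0 is treated like majority 1, by counting zeros. *)
Definition count_in J (b : bool) z : nat := (\sum_(i in J) (z i == b))%N.

Lemma junta_degree_count J b : junta_degree J 1 (fun z => (count_in J b z)%:R).
Proof.
apply: (@eq_junta_degree _ _ (fun z => \sum_(i in J) (z i == b)%:R)) => [z|].
  by rewrite natr_sum.
apply: junta_degree_sum => i iJ.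
apply: (@eq_junta_degree _ _ (fun z => 2^-1 + ((-1) ^+ b / 2) * chi [set i] z)) => [z|].
  by rewrite chi1; case: (z i); case: b; rewrite /= ?expr0 ?expr1; lra.
apply: junta_degreeD; first exact: junta_degree_cst.
by apply: junta_degree_chi; rewrite ?sub1set ?cards1.
Qed.

Lemma junta_degree_poly J b (P : {poly R}) k : (size P <= k.+1)%N ->
  junta_degree J k (fun z => P.[(count_in J b z)%:R]).
Proof.
move=> Pk.
apply: (@eq_junta_degree _ _
  (fun z => \sum_(i < size P) P`_i * (count_in J b z)%:R ^+ i)) => [z|].
  by rewrite horner_coef.
apply: junta_degree_sum => i _.
suff H : junta_degree J i (fun z => (count_in J b z)%:R ^+ i).
  have := junta_degreeM (junta_degree_cst J 0 P`_i) H.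
  rewrite setUid add0n; apply: sub_junta_degree => //.
  by have := leq_trans (ltn_ord i) Pk; rewrite ltnS.
elim: (nat_of_ord i) => [|m IH]; first exact: junta_degree_cst.
have := junta_degreeM (junta_degree_count J b) IH.
rewrite setUid add1n; apply: eq_junta_degree => z.
by rewrite exprS.
Qed.

(** Removing one coordinate of [J] averages [phi] with its shift, which on the binomial side is
    Pascal's rule. *)
Lemma mean_count J b (phi : nat -> R) :
  mean (fun z => phi (count_in J b z)) =
  \sum_(j < #|J|.+1) 'C(#|J|, j)%:R / 2 ^+ #|J| * phi j.
Proof.
move: {-2}#|J| (erefl #|J|) => m; elim: m J phi => [|m IH] J phi Jm.
  move/eqP: Jm; rewrite eq_sym cards_eq0 => /eqP ->.
  rewrite big_ord1 bin0 expr0 divr1 mul1r.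
  rewrite (eq_mean (G := fun z => phi 0%N * chi set0 z)).
    by rewrite meanZ mean_chi eqxx mulr1.
  by move=> z; rewrite /count_in big_set0 chi0 mulr1.
have /card_gt0P[a aJ] : (0 < #|J|)%N by rewrite -Jm.
set J' := J :\ a.
have J'm : m = #|J'| by have := cardsD1 a J; rewrite aJ -Jm => -[].
have cE z : count_in J b z = (count_in J' b z + (z a == b))%N.
  by rewrite /count_in (big_setD1 a aJ) addnC.
have cF z : count_in J' b (flip a z) = count_in J' b z.
  by apply: eq_bigr => i; rewrite !inE => /andP[/negPf ia _]; rewrite ffunE ia.
have -> : mean (fun z => phi (count_in J b z)) =
    2^-1 * (mean (fun z => phi (count_in J' b z)) +
            mean (fun z => phi (count_in J' b z).+1)).
  (* Pair [z] with its flip at [a]: exactly one of the two has the bit [b] there. *)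
  have e : mean (fun z => phi (count_in J b z)) + mean (fun z => phi (count_in J b z)) =
      mean (fun z => phi (count_in J' b z)) + mean (fun z => phi (count_in J' b z).+1).
    rewrite -{1}(mean_flip a) -!meanD; apply: eq_mean => z.
    rewrite !cE cF ffunE eqxx.
    have -> : (true (+) z a == b) = ~~ (z a == b) by move: (z a) (b) => [] [].
    by case: (z a == b); rewrite /= addn0 addn1 // addrC.
  by rewrite -e; lra.
rewrite IH// (IH _ (phi \o succn))//.
have -> : \sum_(j < m.+2) 'C(m.+1, j)%:R / 2 ^+ m.+1 * phi j =
  \sum_(j < m.+2) 'C(m, j)%:R / 2 ^+ m.+1 * phi j +
  \sum_(j < m.+1) 'C(m, j)%:R / 2 ^+ m.+1 * phi j.+1.
  rewrite !(big_ord_recl m.+1) /= !bin0 -addrA; congr (_ + _).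
  rewrite -big_split; apply: eq_bigr => j _ /=.
  by rewrite /bump /= add1n binS natrD !mulrDl.
rewrite (big_ord_recr m.+1) /= bin_small// !mul0r addr0 mulrDr !mulr_sumr.
have n0 : 2 ^+ m != 0 :> R by rewrite expf_neq0.
by congr (_ + _); apply: eq_bigr => j _; rewrite exprS; field.
Qed.

End Fourier.

(** * Bias of characters under limited independence *)

Section Bias.
Import mathcomp.boot.fintype mathcomp.boot.finset.
Variables (R : realType) (I : finType).
Implicit Types (S T A : {set I}) (D : bits I -> R).

Lemma exists_subset_card A k : (k <= #|A|)%N ->
  exists2 B : {set I}, B \subset A & #|B| = k.
Proof.
move=> kA; exists [set x in take k (enum A)].
  by apply/subsetP => x; rewrite inE => /mem_take; rewrite mem_enum.
rewrite cardsE; have /card_uniqP -> := take_uniq k (enum_uniq A).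
by rewrite size_takel// -cardE.
Qed.

Lemma exists_superset_card S t : (#|S| <= t <= #|I|)%N ->
  exists2 T : {set I}, S \subset T & #|T| = t.
Proof.
move=> /andP[St tI]; have [|B BS Bt] := @exists_subset_card (~: S) (t - #|S|).
  by have := cardsC S; lia.
exists (S :|: B); first exact: subsetUl.
have : [disjoint S & B].
  by rewrite -setI_eq0 -subset0 -(setICr S); apply: setIS.
by rewrite -leq_card_setU => /eqP ->; rewrite Bt; lia.
Qed.

Definition restrict S (z : bits I) : bits {i : I | i \in S} :=
  [ffun i => z (val i)].

Lemma sum_marginal S D (G : bits {i : I | i \in S} -> R) :
  \sum_y marginal S D y * G y = \sum_z D z * G (restrict S z).
Proof.
transitivity (\sum_(y : bits {i : I | i \in S})
  \sum_(z : bits I | [forall i, z (val i) == y i]) D z * G y).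
  by apply: eq_bigr => y _; rewrite mulr_suml.
rewrite (exchange_big_dep predT) //=; apply: eq_bigr => z _.
rewrite (big_pred1 (restrict S z))// => y; apply/forallP/eqP => [h|-> i].
  by apply/ffunP => i; rewrite ffunE (eqP (h i)).
by rewrite ffunE.
Qed.

Lemma chi_restrict T (S : {set {i : I | i \in T}}) z :
  chi R (val @: S) z = chi R S (restrict T z).
Proof.
rewrite /chi big_imset /=; last by move=> ? ? _ _; apply: val_inj.
by apply: eq_bigr => i _; rewrite ffunE.
Qed.

(** Enlarge [S] to exactly [t] coordinates. The character has mean 0 under the uniform law, so its
    bias is at most the L1 distance of the marginal to uniform, twice the statistical distance. *)
Lemma wise_independent_bias t gamma D S : wise_independent t gamma D ->
  S != set0 -> (#|S| <= t)%N -> `|\sum_z D z * chi R S z| <= 2 * gamma.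
Proof.
move=> [tI Dt] S0 St.
have [|T ST Tt] := @exists_superset_card S t; first by rewrite St.
pose S' : {set {i : I | i \in T}} := [set i | val i \in S].
have SE : S = val @: S'.
  apply/setP => i; apply/idP/imsetP => [iS|[j]]; last by rewrite inE => ? ->.
  by exists (exist _ i (subsetP ST _ iS)); rewrite ?inE.
have S'0 : S' != set0 by apply: contraNneq S0; rewrite SE => ->; rewrite imset0.
rewrite (eq_bigr (fun z => D z * chi R S' (restrict T z))); last first.
  by move=> z _; rewrite -chi_restrict -SE.
rewrite -sum_marginal.
have u0 : \sum_y unif y * chi R S' y = 0.
  transitivity (mean (chi R S')); first by rewrite /mean mulrC mulr_sumr.
  by rewrite mean_chi (negPf S'0).
rewrite -[X in `|X|]subr0 -[X in _ - X]u0 -sumrB.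
apply: (@le_trans _ _ (2 * stat_dist (marginal T D) unif)); last first.
  by rewrite ler_pM2l// Dt.
rewrite /stat_dist mulrA divff// mul1r.
apply: le_trans (ler_norm_sum _ _ _) _; apply: ler_sum => y _.
by rewrite -mulrBl normrM norm_chi mulr1.
Qed.

Lemma wise_independent_ge0 t gamma D : wise_independent t gamma D -> 0 <= gamma.
Proof.
move=> [tI Dt]; have [|T _ Tt] := @exists_superset_card set0 t.
  by rewrite cards0.
by apply: le_trans (Dt T Tt); rewrite mulr_ge0 ?invr_ge0 ?sumr_ge0.
Qed.

End Bias.

(** * Laws of finitely valued random variables *)

Section Law.
Local Open Scope classical_set_scope.
Variables (R : realType) (d : measure_display) (T : measurableType d).
Variable P : probability T R.

Lemma law_ge0 (A : finType) (Z : T -> A) a : 0 <= law P Z a.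
Proof. exact/fine_ge0. Qed.

Lemma law_comp (A B : finType) (Z : T -> A) (f : A -> B) b :
  (forall a, measurable (Z @^-1` [set a])) ->
  law P (fun w => f (Z w)) b = \sum_(a | f a == b) law P Z a.
Proof.
move=> mZ; rewrite /law.
have -> : (fun w => f (Z w)) @^-1` [set b] =
    \bigcup_(a in [set` [pred a | f a == b]]) Z @^-1` [set a].
  apply/seteqP; split => [w /= <-|w [a /= /eqP <- ->]//].
  by exists (Z w) => //=; rewrite inE.
rewrite measure_fin_bigcup//; last first.
  by move=> a a' _ _ [w [/= -> ->]].
rewrite (fsbigE (enum [pred a | f a == b])) ?enum_uniq//; last 2 first.
- by move=> a; rewrite /= mem_enum.
- by move=> a; rewrite /= mem_enum => ->.
rewrite big_enum_cond /= -sum_fine => [|a _]; last exact: fin_num_measure.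
by apply: eq_bigl => a; rewrite mem_setE !inE andbb.
Qed.

Lemma sum_law (A : finType) (Z : T -> A) :
  (forall a, measurable (Z @^-1` [set a])) -> \sum_a law P Z a = 1.
Proof.
move=> mZ; have := law_comp (fun=> tt) tt mZ.
rewrite {1}/law (_ : _ @^-1` _ = setT); last by apply/seteqP; split.
rewrite probability_setT /= => ->; apply: eq_bigl => a.
by rewrite eqxx.
Qed.

Lemma sum_law_comp (A B : finType) (Z : T -> A) (f : A -> B) (G : B -> R) :
  (forall a, measurable (Z @^-1` [set a])) ->
  \sum_b law P (fun w => f (Z w)) b * G b = \sum_a law P Z a * G (f a).
Proof.
move=> mZ; rewrite [RHS](partition_big f predT) //=; apply: eq_bigr => b _.
rewrite law_comp// mulr_suml; apply: eq_bigr => a /eqP ->//.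
Qed.

(** Measurability of a tuple is coordinatewise, and the fiber is a finite intersection of coordinate
    fibers. *)
Lemma measurable_tuple_fiber n (X : {RV P >-> n.-tuple bool}) x :
  measurable (X @^-1` [set x]).
Proof.
have -> : X @^-1` [set x] =
    \bigcap_(i in [set: 'I_n]) ((fun w => tnth (X w) i) @^-1` [set tnth x i]).
  apply/seteqP; split => [w /= e i _ /=|w h]; first by rewrite e.
  by apply: eq_from_tnth => i; apply: h.
apply: fin_bigcap_measurable => // i _.
have /measurable_fun_tnthP/(_ i) := @measurable_funP _ _ _ _ setT X.
by move=> /(_ measurableT [set tnth x i]); rewrite setTI; apply.
Qed.

Lemma measurable_pair_fiber n (X Y : {RV P >-> n.-tuple bool}) a :
  measurable ((fun w => (X w, Y w)) @^-1` [set a]).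
Proof.
have -> : (fun w => (X w, Y w)) @^-1` [set a] =
    (X @^-1` [set a.1]) `&` (Y @^-1` [set a.2]).
  by case: a => x y; apply/seteqP; split => [w /= [-> ->]|w [/= -> ->]].
by apply: measurableI; apply: measurable_tuple_fiber.
Qed.

End Law.

(** * Majorities of the two blocks *)

Section MajorityBlocks.
Import mathcomp.boot.fintype mathcomp.boot.finset.
Implicit Types (n p r : nat) (b : bool).

Lemma sum_bits_eqE n (x : n.-tuple bool) :
  (\sum_(i < n) (tnth x i == true) + \sum_(i < n) (tnth x i == false) = n)%N.
Proof.
rewrite -big_split /= (eq_bigr (fun=> 1%N)) ?sum1_card ?card_ord// => i _.
by case: (tnth x i).
Qed.

Lemma maj_count n (x : n.-tuple bool) b : maj x = b ->
  (n <= (\sum_(i < n) (tnth x i == b)).*2)%N.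
Proof.
pose f c := (\sum_(i < n) (tnth x i == c))%N.
have e : (\sum_(i < n) tnth x i)%N = f true.
  by apply: eq_bigr => i _; rewrite eqb_id.
have fn : (f true + f false)%N = n := sum_bits_eqE x.
rewrite -/(f b) /maj e; case: leqP => h <-; first by move: (f true) h; lia.
by move: (f true) (f false) fn h; lia.
Qed.

(* In the application [g] is [lshift] or [rshift], the injection of one of the
   two blocks, and [A] is the set of good coordinates. *)
Lemma count_restrict n m (g : 'I_n -> 'I_m) (A : {set 'I_m}) (x : n.-tuple bool)
    (z : bits 'I_m) (J : {set {i | i \in A}}) b :
  injective g -> (forall i, z (g i) = tnth x i) ->
  (forall i, i \in J -> exists k, val i = g k) ->
  (\sum_(i < n) (tnth x i == b) <= count_in J b (restrict A z) + (n - #|J|))%N.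
Proof.
move=> gI zg Jg.
pose K := [set k | g k \in val @: J].
have KJ : val @: J = g @: K.
  apply/setP => i; apply/imsetP/imsetP => [[j jJ ->]|[k]].
    have [k jk] := Jg j jJ; exists k => //.
    by rewrite inE -jk imset_f.
  by rewrite inE => /imsetP[j jJ ->] ->; exists j.
have cK : #|K| = #|J|.
  rewrite -(card_imset (mem K) gI) -KJ card_imset//; exact: val_inj.
have -> : count_in J b (restrict A z) = (\sum_(k in K) (tnth x k == b))%N.
  rewrite /count_in; transitivity (\sum_(i in val @: J) (z i == b))%N.
    rewrite big_imset /=; last by move=> ? ? _ _; apply: val_inj.
    by apply: eq_bigr => i _; rewrite ffunE.
  rewrite KJ big_imset /=; last by move=> ? ? _ _; apply: gI.
  by apply: eq_bigr => i _; rewrite zg.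
rewrite (bigID (mem K)) /= leq_add2l -cK.
apply: (@leq_trans (\sum_(i | i \notin K) 1)); first by apply: leq_sum => i _; case: eqP.
rewrite sum1_card; have := cardC (mem K); rewrite card_ord => e.
rewrite -[X in (_ <= X - _)%N]e addKn.
by apply: eq_leq; apply: eq_card => i; rewrite !inE.
Qed.

(** At least [n / 2] bits of the block equal [b], and at most [r] coordinates lie outside [J]; so at
    least [n / 2 - r >= p - r] remain. *)
Lemma maj_count_restrict n m (g : 'I_n -> 'I_m) (A : {set 'I_m})
    (x : n.-tuple bool) (z : bits 'I_m) (J : {set {i | i \in A}}) p r b :
  injective g -> (forall i, z (g i) = tnth x i) ->
  (forall i, i \in J -> exists k, val i = g k) ->
  #|J| = p.*2 -> (n <= p.*2 + r)%N -> (p.*2 <= n)%N -> maj x = b ->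
  (p <= count_in J b (restrict A z) + r)%N.
Proof.
move=> gI zg Jg Jp nr pn /maj_count; have := count_restrict b gI zg Jg.
by rewrite Jp; move: (bigop.body _ _ _) (count_in _ _ _) => s c; lia.
Qed.

Lemma block_card n m (g : 'I_n -> 'I_m) (Q : {set 'I_m}) : injective g ->
  (n - #|Q| <= #|[set i : {i | i \in ~: Q} | [exists k, val i == g k]]|)%N.
Proof.
move=> gI; rewrite -(card_imset _ val_inj).
apply: (@leq_trans #|(g @: setT) :\: Q|).
  rewrite cardsD card_imset// cardsT card_ord leq_sub2l//.
  exact/subset_leq_card/subsetIr.
apply/subset_leq_card/subsetP => i; rewrite inE => /andP[iQ /imsetP[k _ ik]].
have iC : i \in ~: Q by rewrite inE.
apply/imsetP; exists (exist _ i iC) => //.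
by rewrite inE; apply/existsP; exists k; rewrite /= ik.
Qed.

Variables (R : realType) (d : measure_display) (T : measurableType d).
Variables (P : probability T R) (n q t : nat) (gamma : R).
Variables (X Y : {RV P >-> n.-tuple bool}).

(** The event splits according to the value of [maj (X w)]. Each of the two cases is dominated by a
    product over disjoint sets of good bits, of uniform mean at most [mu ^ 2]. *)
Lemma xor_prob_le p r k (mu : R) (F : {poly R}) c :
  (0 < t)%N -> NOBF q t gamma (law P (fun w => concat_bits (X w) (Y w))) ->
  (p.*2 <= n - q)%N -> (n <= p.*2 + r)%N -> (k + k <= t)%N ->
  (size F <= k.+1)%N -> (forall x, 0 <= F.[x]) ->
  (forall j, (p <= j + r)%N -> 1 <= F.[j%:R]) ->
  \sum_(j < p.*2.+1) ('C(p.*2, j)%:R / 4 ^+ p) * F.[j%:R] <= mu ->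
  law P (fun w => maj (X w) (+) maj (Y w)) c <=
    2 * mu ^+ 2 * (1 + 2 * (gamma * ((2 * n) ^ t)%:R)).
Proof.
move=> t0 [Q [Qq wi]] pn nr kt sF F0 F1 Fmu.
have gamma0 := wise_independent_ge0 wi.
have mZ := measurable_pair_fiber X Y.
have lI := @lshift_inj n n; have rI := @rshift_inj n n.
pose block (g : 'I_n -> 'I_(n + n)) :=
  [set i : {i | i \in ~: Q} | [exists k, val i == g k]].
have sub g : injective g -> exists2 J : {set {i | i \in ~: Q}},
    J \subset block g & #|J| = p.*2.
  move=> gI; apply: exists_subset_card; apply: leq_trans (block_card Q gI).
  by rewrite (leq_trans pn)// leq_sub2l.
have [J1 J1s J1c] := sub _ lI; have [J2 J2s J2c] := sub _ rI.
have J12 : [disjoint J1 & J2].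
  rewrite -setI_eq0; apply/eqP/setP => i; rewrite !inE; apply/negP => /andP[].
  move=> /(subsetP J1s) + /(subsetP J2s); rewrite !inE.
  by move=> /existsP[j /eqP ->] /existsP[j' /eqP/eqP]; rewrite eq_lrshift.
pose G z := \sum_(b : bool)
  F.[(count_in J1 b z)%:R] * F.[(count_in J2 (b (+) c) z)%:R].
have G0 z : 0 <= G z by apply: sumr_ge0 => b _; rewrite mulr_ge0.
have Gge1 (a : n.-tuple bool * n.-tuple bool) : maj a.1 (+) maj a.2 = c ->
    1 <= G (restrict (~: Q) (concat_bits a.1 a.2)).
  move=> ac; rewrite /G (bigD1 (maj a.1))//= ler_wpDr//.
    by apply: sumr_ge0 => b _; rewrite mulr_ge0.
  rewrite -[leLHS]mulr1; apply: ler_pM => //; apply: F1.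
    apply: (@maj_count_restrict _ _ (@lshift n n)) => //.
    - by move=> i; rewrite ffunE (tnth_lshift a.1 a.2).
    - by move=> i /(subsetP J1s); rewrite inE => /existsP[j /eqP]; exists j.
    by rewrite (leq_trans pn)// leq_subr.
  apply: (@maj_count_restrict _ _ (@rshift n n) _ a.2) => //.
  - by move=> i; rewrite ffunE (tnth_rshift a.1 a.2).
  - by move=> i /(subsetP J2s); rewrite inE => /existsP[j /eqP]; exists j.
  - by rewrite (leq_trans pn)// leq_subr.
  - by rewrite -ac addKb.
set D := law P _ in wi.
apply: (@le_trans _ _ (\sum_z marginal (~: Q) D z * G z)).
  rewrite sum_marginal /D.
  rewrite (sum_law_comp P (fun a => concat_bits a.1 a.2)
    (fun x => G (restrict (~: Q) x)) mZ).
  rewrite (law_comp P (fun a => maj a.1 (+) maj a.2) c mZ) big_mkcond /=.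
  apply: ler_sum => a _; case: eqP => [/Gge1 h|_].
    by rewrite ler_peMr ?law_ge0.
  by rewrite mulr_ge0 ?law_ge0.
have D1 : \sum_z marginal (~: Q) D z = 1.
  rewrite (eq_bigr (fun z => marginal (~: Q) D z * 1)) => [|z _]; last by rewrite mulr1.
  rewrite (sum_marginal D (fun=> 1)) /D.
  rewrite (sum_law_comp P (fun a => concat_bits a.1 a.2) (fun=> 1) mZ).
  by rewrite -[RHS](sum_law P mZ); apply: eq_bigr => a _; rewrite mulr1.
have Fdeg (J : {set {i | i \in ~: Q}}) b :
    junta_degree J k (fun z => F.[(count_in J b z)%:R]).
  exact: junta_degree_poly.
have Gdeg : junta_degree setT t G.
  apply: junta_degree_sum => b _.
  apply: sub_junta_degree (junta_degreeM (Fdeg J1 b) (Fdeg J2 (b (+) c))) => //.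
apply: le_trans (biased_mean_le t0 gamma0 D1 _ Gdeg G0) _.
  by move=> S S0 St; apply: wise_independent_bias wi S0 St.
have Fmean (J : {set {i | i \in ~: Q}}) b : #|J| = p.*2 ->
    0 <= mean (fun z => F.[(count_in J b z)%:R]) <= mu.
  move=> Jp; rewrite mean_ge0//= (mean_count J b (fun j => F.[j%:R])) Jp.
  by rewrite -mul2n exprM (_ : 2 ^+ 2 = 4) ?mul2n//; ring.
have mG : mean G <= 2 * mu ^+ 2.
  rewrite /G mean_sum big_bool /= (mean_junta_mul J12 (Fdeg J1 true) (Fdeg J2 _)).
  rewrite (mean_junta_mul J12 (Fdeg J1 false) (Fdeg J2 _)).
  rewrite mulr_natl mulr2n expr2.
  have /andP[? ?] := Fmean J1 true J1c; have /andP[? ?] := Fmean J1 false J1c.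
  have /andP[? ?] := Fmean J2 (true (+) c) J2c.
  have /andP[? ?] := Fmean J2 (false (+) c) J2c.
  by apply: lerD; apply: ler_pM.
apply: ler_pM => //.
- exact: mean_ge0.
- by rewrite addr_ge0// mulr_ge0// mulr_ge0.
rewrite lerD2l -mulrA ler_wpM2l// ler_wpM2l// ler_nat leq_exp2r//.
by rewrite card_sig (leq_trans (max_card _))// card_ord mul2n addnn.
Qed.

End MajorityBlocks.

(** * Choice of parameters and conclusion *)

Local Open Scope classical_set_scope.
Local Open Scope ring_scope.

(** The two masses sum to 1, so an upper bound on one is a lower bound on the other; this is why
    majorants alone suffice. *)
Lemma stat_dist_bool_le (R : realType) (D : bool -> R) (e : R) :
  D true + D false = 1 -> (forall c, D c <= 2^-1 + e) -> stat_dist D unif <= e.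
Proof.
move=> D1 De; rewrite /stat_dist big_bool /= /unif card_bool.
have -> : D false - 2^-1 = - (D true - 2^-1) by lra.
rewrite normrN.
have : `|D true - 2^-1| <= e.
  have := De true; have := De false; rewrite ler_norml => h1 h2.
  by apply/andP; split; lra.
by lra.
Qed.

(** Rounding costs constant factors: [2 p + 1 >= n / 4] and [t %/ 8 >= t / 16], whence
    [252 = 63 * 4]. The summand 2 of [q + 2] gives [4 / sqrt n], at most [8 / sqrt t] because
    [t <= 2 n]. *)
Lemma majorant_error_le (R : realType) (n q t : nat) :
  (8 <= t)%N -> (t <= 2 * n)%N -> (4 * q.+1 ^ 2 <= n)%N ->
  q.+2%:R / Num.sqrt ((n - q)./2).*2.+1%:R
    + 63 * expR 1 / Num.sqrt (t %/ 8)%:R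
  <= (252 * expR 1 + 8) * ((Num.sqrt t%:R)^-1 + q%:R / Num.sqrt n%:R) :> R.
Proof.
move=> t8 tn qn; set e := expR 1.
have e0 : 0 <= e := expR_ge0 1.
have sqrt_le (a b k : nat) : (0 < b)%N -> (0 < a)%N -> (b <= k ^ 2 * a)%N ->
    (Num.sqrt a%:R)^-1 <= k%:R * (Num.sqrt b%:R)^-1 :> R.
  move=> b0 a0 bka; have sb : 0 < Num.sqrt b%:R :> R by rewrite sqrtr_gt0 ltr0n.
  have sa : 0 < Num.sqrt a%:R :> R by rewrite sqrtr_gt0 ltr0n.
  rewrite ler_pdivlMr// mulrC ler_pdivrMr//.
  have -> : k%:R = Num.sqrt (k%:R ^+ 2) :> R by rewrite sqrtr_sqr ger0_norm.
  by rewrite -sqrtrM ?sqr_ge0// ler_wsqrtr// -natrX -natrM ler_nat.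
have H1 := sqrt_le (((n - q)./2).*2.+1) n 2.
have H2 := sqrt_le (t %/ 8)%N t 4.
have H3 := sqrt_le n t 2.
have {H1} H1 := H1 ltac:(lia) ltac:(lia) ltac:(nia).
have {H2} H2 := H2 ltac:(lia) ltac:(lia) ltac:(nia).
have {H3} H3 := H3 ltac:(lia) ltac:(lia) ltac:(nia).
have q0 : 0 <= q%:R :> R by [].
have -> : q.+2%:R = q%:R + 2 :> R by rewrite -addn2 natrD.
set x := (Num.sqrt t%:R)^-1 in H2 H3 *.
set y := (Num.sqrt n%:R)^-1 in H1 H3 *.
have x0 : 0 <= x by rewrite invr_ge0 sqrtr_ge0.
have y0 : 0 <= y by rewrite invr_ge0 sqrtr_ge0.
have h1 := ler_wpM2l (addr_ge0 q0 (ler0n R 2)) H1.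
have h2 := ler_wpM2l (mulr_ge0 (ler0n R 63) e0) H2.
have h3 : 0 <= q%:R * y by rewrite mulr_ge0.
have h4 : 0 <= e * (q%:R * y) by rewrite mulr_ge0.
apply: le_trans (lerD h1 h2) _; lra.
Qed.

(** Two factors of degree [4 N] must fit into degree [t], hence [t %/ 8]. The slack is [q.+1]: up to
    [q] bad bits in a block, and one more good bit dropped for parity. *)
Lemma majorant_parameters (n q t N p : nat) :
  (8 <= t)%N -> (t <= 2 * n)%N -> (4 * q.+1 ^ 2 <= n)%N ->
  N = (t %/ 8)%N -> p = (n - q)./2 ->
  [/\ (0 < N <= p)%N, (q.+1 ^ 2 <= p.*2)%N, (p.*2 <= n - q)%N,
      (n <= p.*2 + q.+1)%N & (4 * N + 4 * N <= t)%N].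
Proof.
move=> t8 tn qn NE pE.
have Nt : (8 * N <= t < 8 * N + 8)%N by rewrite NE; lia.
have qq : (q.+1 <= q.+1 ^ 2)%N by rewrite -mulnn leq_pmulr.
have pn : (p.*2 <= n - q <= p.*2.+1)%N by rewrite pE; lia.
by move: (q.+1 ^ 2)%N qn qq => s qn qq; clear NE pE; split; lia.
Qed.

Theorem theorem3p2 (R : realType) :
  exists C : R,
    forall (d : measure_display) (T : measurableType d) (P : probability T R)
      (n q t : nat) (gamma : R) (X Y : {RV P >-> n.-tuple bool}),
      (0 < t)%N ->
      NOBF q t gamma (law P (fun w => concat_bits (X w) (Y w))) ->
      stat_dist (law P (fun w => maj (X w) (+) maj (Y w))) unif
        <= C * ((Num.sqrt t%:R)^-1 + q%:R / Num.sqrt n%:R)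
           + (2 * n)%:R ^+ t * gamma.
Proof.
(* With [delta = C0 * (x + y)] and [delta, g <= 1/2]: [2 (1/2 + delta)^2 <= 1/2 + 3 delta], and
   multiplying by [1 + 2 g] gives at most [1/2 + 6 delta + g]; hence the factor 6. *)
set C0 : R := 252 * expR 1 + 8; exists (6 * C0).
have C08 : 8 <= C0 by rewrite lerDr mulr_ge0 ?expR_ge0.
move=> d T P n q t gamma X Y t0 H.
have [tn gamma0] : (t <= 2 * n)%N /\ 0 <= gamma.
  case: H => Q [_ wi]; split; last exact: wise_independent_ge0 wi.
  case: wi => tI _; apply: leq_trans tI _.
  by rewrite card_sig (leq_trans (max_card _))// card_ord mul2n addnn.
set g : R := (2 * n)%:R ^+ t * gamma.
have g0 : 0 <= g by rewrite mulr_ge0 ?exprn_ge0.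
set x := (Num.sqrt t%:R)^-1; set y := q%:R / Num.sqrt n%:R.
have x0 : 0 <= x by rewrite invr_ge0 sqrtr_ge0.
have y0 : 0 <= y by rewrite mulr_ge0 ?invr_ge0 ?sqrtr_ge0.
have mZ := measurable_pair_fiber X Y.
set D := law P _.
have D0 c : 0 <= D c := law_ge0 P _ c.
have D1 : D true + D false = 1.
  have := sum_law_comp P (fun a => maj a.1 (+) maj a.2) (fun=> 1) mZ.
  rewrite big_bool /= !mulr1 => ->; rewrite -[RHS](sum_law P mZ).
  by apply: eq_bigr => a _; rewrite mulr1.
apply: stat_dist_bool_le => // c.
have Dc1 : D c <= 1.
  by have := D0 true; have := D0 false; case: c; move: D1; lra.
(* A bound of at least [1/2] is trivial. Otherwise its smallness forces [t] and [n] to be large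
   enough for the parameters, and [delta] and [g] below [1/2]. *)
have [big|small] := leP 2^-1 (C0 * (x + y) * 6 + g); first by move: big; lra.
have xy1 : x + y < 2^-1 / 48.
  have : 0 <= (C0 - 8) * (x + y) by apply: mulr_ge0; [rewrite subr_ge0|exact: addr_ge0].
  move: small; lra.
have t8 : (8 <= t)%N.
  rewrite leqNgt; apply/negP => t8.
  have : 9^-1 <= x.
    rewrite lef_pV2 ?posrE ?sqrtr_gt0 ?ltr0n//.
    have -> : 9 = Num.sqrt (9 ^+ 2) :> R by rewrite sqrtr_sqr ger0_norm.
    by rewrite ler_wsqrtr// -natrX ler_nat; lia.
  by move: xy1 y0; lra.
(* Smallness of [y] gives [64 q^2 <= n], which covers [q >= 1]; for [q = 0], [n >= 4] follows from
   [8 <= t <= 2 n]. *)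
have qn : (4 * q.+1 ^ 2 <= n)%N.
  have n0 : (0 < n)%N by lia.
  have sn : 0 < Num.sqrt n%:R :> R by rewrite sqrtr_gt0 ltr0n.
  have : (8 * q)%:R <= Num.sqrt n%:R :> R.
    have : y <= 8^-1 by move: xy1 x0; lra.
    by rewrite /y ler_pdivrMr// ler_pdivlMl// natrM.
  rewrite -(@ler_pXn2r _ 2)// ?nnegrE ?sqrtr_ge0// sqr_sqrtr// -natrX ler_nat.
  rewrite -!mulnn; nia.
pose N := (t %/ 8)%N; pose p := ((n - q)./2)%N.
have [/andP[N0 Np] rp pn np Nt] := majorant_parameters t8 tn qn erefl (erefl p).
have [F [sF F0 F1 Fmu]] := binomial_majorant R N0 Np rp.
have err := majorant_error_le R t8 tn qn.
rewrite -/C0 -/x -/y in err; set delta := C0 * (x + y) in err small.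
have delta0 : 0 <= delta by apply: mulr_ge0; [move: C08; lra|exact: addr_ge0].
have Fmu' : \sum_(j < p.*2.+1) ('C(p.*2, j)%:R / 4 ^+ p) * F.[j%:R]
    <= 2^-1 + delta.
  by apply: le_trans Fmu _; rewrite -addrA lerD2l.
have := xor_prob_le c t0 H pn np Nt sF F0 F1 Fmu'.
rewrite natrX [gamma * _]mulrC -/g -/D => Dle.
have -> : 6 * C0 * (x + y) = 6 * delta by rewrite mulrA.
have dd : 0 <= delta * (2^-1 - delta) by apply: mulr_ge0 => //; lra.
have dg : 0 <= delta * (2^-1 - g) by apply: mulr_ge0 => //; lra.
apply: le_trans Dle _.
apply: (@le_trans _ _ ((2^-1 + 3 * delta) * (1 + 2 * g))).
  by rewrite ler_wpM2r ?addr_ge0 ?mulr_ge0//; move: dd; rewrite !expr2; lra.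
lra.
Qed.
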